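(* Let $N$ be a prime, let $\alpha\in(0,1)$ and $K\geq 1$ be real numbers, and let $A\subseteq \mathbb{Z}/N\mathbb{Z}$ be a set with $|A|=\alpha N$ and $\min(|A+A|,|A-A|)=K|A|$. Suppose that $\alpha\leq (16K)^{-12K^2}$. Then the diameter of $A$ is at most \[ 12\,\alpha^{1/(4K^2)}\sqrt{\log(1/\alpha)}\,N. \]
   Context: For sets $X,Y$ in an abelian group, $X+Y=\{x+y: x\in X, y\in Y\}$ and $X-Y=\{x-y:x\in X,y\in Y\}$. The diameter $\mathrm{diam}\,A$ of a set $A\subseteq\mathbb{Z}/N\mathbb{Z}$ is the smallest integer $l$ for which there exist $a,d$ such that $A\subseteq\{a,a+d,\dots,a+ld\}$. *)

(* Defs.v *)
From mathcomp Require Import all_boot all_order all_algebra.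

Set Implicit Arguments.
Unset Strict Implicit.
Unset Printing Implicit Defensive.

Import GRing.Theory.
Local Open Scope ring_scope.

Definition sumset (G : finZmodType) (X Y : {set G}) : {set G} :=
  [set x + y | x in X, y in Y].

Definition diffset (G : finZmodType) (X Y : {set G}) : {set G} :=
  [set x - y | x in X, y in Y].

Section Diameter.
Variable N : nat.
Implicit Types (A : {set 'Z_N}) (a d : 'Z_N) (l : nat).

Definition progression a d l : {set 'Z_N} := [set a + d *+ i | i : 'I_l.+1].

Definition in_progression A l : bool :=
  [exists a, exists d, A \subset progression a d l].

Lemma in_progression_ex A : exists l, in_progression A l.
Proof.
exists (Zp_trunc N).+1; apply/existsP; exists 0; apply/existsP; exists 1.
by apply/subsetP=> x _; apply/imsetP; exists x; rewrite // add0r natr_Zp.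
Qed.

(* The minimum over l >= 0 agrees with the minimum over all integers l when A
   is nonempty. *)
Definition diam A : nat := ex_minn (in_progression_ex A).

End Diameter.

(* Main.v *)
Require Import Defs.
From mathcomp Require Import all_boot all_order all_algebra.
From mathcomp Require Import reals exp trigo derive topology normedtype complex.
From mathcomp Require Import zify ring lra.

Set Implicit Arguments.
Unset Strict Implicit.
Unset Printing Implicit Defensive.

Import Order.TTheory GRing.Theory Num.Theory.
Import numFieldTopology.Exports numFieldNormedType.Exports.
Import Normc.
Local Open Scope ring_scope.

(** Translate so that [0 \in A], and let [B] be [A] or [- A], so that
    [|A + B| = K |A|].  Choose [x_0, x_1, ...] in [B] greedily, each translate
    [A + x_j] covering as many points outside [U_j], the union of [A] and the
    previous translates, as possible.  The gains decrease and sum to at most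
    [(K - 1) |A|], so after [m ~ 2.4 K^2] steps every translate [A + y] with
    [y] in [B] lies in [U_m] up to a proportion [O(1 / K)].  Hence [A], [A + box]
    and a cube of side [h] generated by the [x_i] have almost all their triple
    sums in a slightly larger [A + box], where the size of the box is chosen by
    pigeonhole so that [A + box] hardly grows.  Counting these sums by Fourier
    analysis yields [r != 0] with [|A^(r)| >= (1 - 1 / (2 K)) |A|] for which all
    [r x_i] lie within [2 N / h] of [0].

    Two more applications of the greedy inequality rectify [r B].  A weight
    peaked opposite to the phase of [A^(r)] shows that the residues of [r B] are
    less than [0.33 N] in absolute value, so that sums do not wrap around; then
    the extreme elements of [r B] show that [r A] is concentrated, up to few
    points on each side, in an arc of radius [2 N / h], and a single [y] in [B]
    with [r y] further than [6 N / h] from [0] would make every one of the first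
    [2.5 K] gains too large.  So the diameter of [A] is at most [12 N / h]. *)

(** * Sumsets and the greedy cover *)

Definition translate (G : finZmodType) (y : G) (A : {set G}) : {set G} :=
  [set a + y | a in A].

Section Translates.
Variable G : finZmodType.
Implicit Types (A B U : {set G}) (x y : G).

Lemma mem_translate y A z : (z \in translate y A) = (z - y \in A).
Proof.
apply/imsetP/idP => [[a aA ->]|h]; first by rewrite addrK.
by exists (z - y) => //; rewrite subrK.
Qed.

Lemma card_translate y A : #|translate y A| = #|A|.
Proof. by rewrite card_imset //; apply: addIr. Qed.

Lemma translate0 A : translate 0 A = A.
Proof. by apply/setP => z; rewrite mem_translate subr0. Qed.

Lemma translate_sub_sumset y A B : y \in B -> translate y A \subset sumset A B.
Proof.
by move=> yB; apply/subsetP => _ /imsetP [a aA ->]; apply: imset2_f.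
Qed.

Lemma sumsetP A B z :
  reflect (exists2 a, a \in A & exists2 b, b \in B & z = a + b)
          (z \in sumset A B).
Proof.
apply: (iffP imset2P) => [[a b aA bB ->]|[a aA [b bB ->]]].
  by exists a => //; exists b.
by exists a b.
Qed.

Lemma leq_card_sumset A B : (#|sumset A B| <= #|A| * #|B|)%N.
Proof.
rewrite /sumset curry_imset2X; apply: leq_trans (leq_imset_card _ _) _.
by rewrite cardsX.
Qed.

Lemma sumsetA A B U : sumset (sumset A B) U = sumset A (sumset B U).
Proof.
apply/setP => z; apply/sumsetP/sumsetP.
  move=> [_ /sumsetP [a aA [b bB ->]] [u uU ->]].
  by exists a => //; exists (b + u); rewrite ?addrA //; apply: imset2_f.
move=> [a aA [_ /sumsetP [b bB [u uU ->]] ->]].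
by exists (a + b); [apply: imset2_f | exists u; rewrite ?addrA].
Qed.

Lemma card_sumset_translate y A B : #|sumset (translate y A) B| = #|sumset A B|.
Proof.
rewrite -(card_translate y (sumset A B)); congr #|pred_of_set _|.
apply/setP => z; rewrite mem_translate; apply/sumsetP/sumsetP.
  move=> [_ /imsetP [a aA ->] [b bB ->]].
  by exists a => //; exists b; rewrite // addrAC addrK.
move=> [a aA [b bB ezy]]; exists (a + y); first exact: imset_f.
by exists b; rewrite // addrAC -ezy subrK.
Qed.

Lemma sumsetC A B : sumset A B = sumset B A.
Proof.
by apply/setP => z; apply/sumsetP/sumsetP => -[a aA [b bB ->]];
  exists b => //; exists a; rewrite // addrC.
Qed.

Lemma sumsetNN A B :
  sumset [set - a | a in A] [set - b | b in B] = [set - z | z in sumset A B].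
Proof.
apply/setP => z; apply/sumsetP/imsetP.
  move=> [_ /imsetP [a aA ->] [_ /imsetP [b bB ->] ->]].
  by exists (a + b); rewrite ?opprD //; apply: imset2_f.
move=> [_ /sumsetP [a aA [b bB ->]] ->]; exists (- a); first exact: imset_f.
by exists (- b); rewrite ?opprD //; apply: imset_f.
Qed.

Lemma card_oppset A : #|[set - a | a in A]| = #|A|.
Proof. by rewrite card_imset //; apply: oppr_inj. Qed.

End Translates.

(** The sequences are infinite, so that each use fixes its own number of steps; late gains may be
    zero. *)
Definition greedy (G : finZmodType) (A B : {set G}) (x : nat -> G)
    (U : nat -> {set G}) :=
  [/\ U 0%N = A, forall j, x j \in B,
      forall j, U j.+1 = U j :|: translate (x j) A
    & forall j y, y \in B ->
        (#|translate y A :\: U j| <= #|translate (x j) A :\: U j|)%N].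

Section Greedy.
Variables (G : finZmodType) (A B : {set G}).

Lemma greedy_exists : 0 \in B -> exists x U, greedy A B x U.
Proof.
move=> B0.
pose nx (V : {set G}) := [arg max_(y > 0 in B) #|translate y A :\: V|].
pose U := fix U j := if j is i.+1 then U i :|: translate (nx (U i)) A else A.
exists (fun j => nx (U j)), U; split => // [j|j y yB];
  by rewrite /nx; case: arg_maxnP => // z zB; apply.
Qed.

Variables (x : nat -> G) (U : nat -> {set G}).
Hypothesis gr : greedy A B x U.

Lemma greedyE j z :
  (z \in U j) = (z \in A) || [exists i : 'I_j, z \in translate (x i) A].
Proof.
case: gr => U0 _ US _; elim: j => [|j IH].
  by rewrite U0; case: existsP => [[[]]//|_]; rewrite orbF.
rewrite US inE IH -orbA; congr (_ || _); apply/orP/existsP.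
  case=> [/existsP [i zi]|zj]; first by exists (widen_ord (leqnSn j) i).
  by exists ord_max.
case=> i; have [->|] := eqVneq i ord_max; first by right.
rewrite -val_eqE /= => ni zi; left; apply/existsP.
have hi : (i < j)%N by rewrite ltn_neqAle ni -ltnS ltn_ord.
by exists (Ordinal hi).
Qed.

Lemma greedy_mono i j : (i <= j)%N -> U i \subset U j.
Proof.
move=> ij; apply/subsetP => z; rewrite !greedyE.
case/orP => [->//|/existsP [k zk]].
by apply/orP; right; apply/existsP; exists (widen_ord ij k).
Qed.

Lemma greedy_sub j : 0 \in B -> U j \subset sumset A B.
Proof.
case: gr => _ xB _ _ B0; apply/subsetP => z; rewrite greedyE.
case/orP => [zA|/existsP [k zk]].
  by apply: (subsetP (translate_sub_sumset A B0)); rewrite translate0.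
exact: (subsetP (translate_sub_sumset A (xB k))).
Qed.

Lemma greedy_card n :
  #|U n| = (#|A| + \sum_(j < n) #|translate (x j) A :\: U j|)%N.
Proof.
case: gr => U0 _ US _; elim: n => [|n IH]; first by rewrite big_ord0 addn0 U0.
rewrite big_ord_recr addnA -IH US; set T := translate _ _.
by rewrite cardsU cardsD -[in LHS]addnBA ?subset_leq_card ?subsetIr // setIC.
Qed.

(** At step [j] the choice [x j] gains at least as much as [y j], and the gains of the [x j] add up
    to [#|U n| - #|A|], where [U n] lies in [A + B]. *)
Lemma greedy_gains n (y : nat -> G) : 0 \in B -> (forall j, y j \in B) ->
  (#|A| + \sum_(j < n) #|translate (y j) A :\: U j| <= #|sumset A B|)%N.
Proof.
move=> B0 yB; apply: leq_trans (subset_leq_card (greedy_sub n B0)).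
rewrite greedy_card leq_add2l; apply: leq_sum => j _.
by case: gr => _ _ _; apply.
Qed.

(** Since the [U j] increase, [A + y] would gain at each of the steps [0, ..., m] at least what it
    gains over [U m]. *)
Lemma greedy_last m y : 0 \in B -> y \in B ->
  (#|A| + m.+1 * #|translate y A :\: U m| <= #|sumset A B|)%N.
Proof.
move=> B0 yB; apply: leq_trans (greedy_gains m.+1 B0 (fun=> yB)).
rewrite leq_add2l -[X in (X * _)%N]card_ord -sum_nat_const.
apply: leq_sum => j _; apply/subset_leq_card/setDS/greedy_mono.
by rewrite -ltnS.
Qed.

Lemma greedy_deficiency (R : numDomainType) (K : R) m : 0 \in B ->
  #|sumset A B|%:R = K * #|A|%:R ->
  exists2 D : nat, forall y, y \in B -> (#|translate y A :\: U m| <= D)%N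
    & m.+1%:R * D%:R <= (K - 1) * #|A|%:R.
Proof.
move=> B0 dbl; exists ((#|sumset A B| - #|A|) %/ m.+1)%N.
  move=> y yB; rewrite leq_divRL // mulnC.
  have h1 := greedy_last m B0 yB.
  by rewrite leq_subRL // (leq_trans (leq_addr _ _) h1).
rewrite mulrBl mul1r lerBrDl -dbl -natrM -natrD ler_nat.
have h1 := greedy_gains 0 B0 (fun=> B0).
rewrite -leq_subRL ?(leq_trans (leq_addr _ _) h1) // mulnC.
exact: leq_trunc_div.
Qed.

End Greedy.

(** * Growth of boxes *)

Definition box (G : finZmodType) (x : nat -> G) (m k : nat) : {set G} :=
  [set \sum_(i < m) x i *+ f i | f : {ffun 'I_m -> 'I_k.+1}].

Section Box.
Variables (G : finZmodType) (x : nat -> G) (m : nat).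
Implicit Types (A B : {set G}).

Lemma boxP k z :
  reflect (exists2 f : nat -> nat, (forall i, (i < m)%N -> (f i <= k)%N)
             & z = \sum_(i < m) x i *+ f i)
          (z \in box x m k).
Proof.
apply: (iffP imsetP) => [[f _ ->]|[f fk ->]].
  exists (fun i => if insub i is Some j then nat_of_ord (f j) else 0%N).
    by move=> i im; rewrite insubT -ltnS.
  by apply: eq_bigr => i _; rewrite valK.
exists [ffun i : 'I_m => inord (f i)] => //; apply: eq_bigr => i _.
by rewrite ffunE inordK // ltnS fk.
Qed.

Lemma box0 k : 0 \in box x m k.
Proof.
apply/boxP; exists (fun=> 0%N) => //.
by rewrite big1 // => i _; rewrite mulr0n.
Qed.

Lemma boxD k l y z : y \in box x m k -> z \in box x m l ->
  y + z \in box x m (k + l).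
Proof.
move=> /boxP [f fk ->] /boxP [g gl ->]; apply/boxP.
exists (fun i => f i + g i)%N.
  by move=> i im; apply: leq_add; [apply: fk | apply: gl].
by rewrite -big_split; apply: eq_bigr => i _; rewrite mulrnDr.
Qed.

Lemma mem_box1 i : (i < m)%N -> x i \in box x m 1.
Proof.
move=> im; apply/boxP; exists (fun j => nat_of_bool (j == i)).
  by move=> j _; case: eqP.
rewrite (bigD1 (Ordinal im)) //= eqxx big1 ?addr0 // => j.
by rewrite -val_eqE /= => /negPf ->.
Qed.

Lemma leq_card_box k : (#|box x m k| <= k.+1 ^ m)%N.
Proof.
apply: leq_trans (leq_imset_card _ _) _.
by rewrite card_ffun !card_ord.
Qed.

(** A coefficient up to [2 k + 1] is at most [k], or is [k + 1] plus at most [k]; [D] consists of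
    the corners, with coefficients [0] or [k + 1]. *)
Lemma box_double k :
  exists2 D : {set G}, (#|D| <= 2 ^ m)%N & box x m k.*2.+1 \subset sumset (box x m k) D.
Proof.
exists (box (fun i => x i *+ k.+1) m 1).
  apply: leq_trans (leq_imset_card _ _) _.
  by rewrite card_ffun !card_ord.
apply/subsetP => z /boxP [f fk ->]; apply/sumsetP.
exists (\sum_(i < m) x i *+ (f i - k.+1 * (k < f i))).
  apply/boxP; exists (fun i => f i - k.+1 * (k < f i))%N => // i /fk.
  by case: ltnP => /= ? ?; lia.
exists (\sum_(i < m) x i *+ k.+1 *+ (k < f i)%N).
  apply/imsetP; exists [ffun i : 'I_m => inord (k < f i)] => //.
  by apply: eq_bigr => i _; rewrite ffunE inordK // ltnS leq_b1.
rewrite -big_split; apply: eq_bigr => i _ /=.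
rewrite -mulrnA -mulrnDr; congr (_ *+ _).
by case: ltnP => /= ?; lia.
Qed.

Lemma card_sumset_box_double A k :
  (#|sumset A (box x m k.*2.+1)| <= 2 ^ m * #|sumset A (box x m k)|)%N.
Proof.
have [D cD sD] := box_double k.
apply: leq_trans (_ : #|sumset (sumset A (box x m k)) D| <= _)%N.
  apply/subset_leq_card/subsetP => z /sumsetP [a aA [b /(subsetP sD) bD ->]].
  by rewrite sumsetA; apply: imset2_f.
apply: leq_trans (leq_card_sumset _ _) _.
by rewrite mulnC leq_mul2r cD orbT.
Qed.

(* A box is a translate of its negative. *)
Lemma card_sumset_opp_box A k :
  #|sumset [set - a | a in A] (box x m k)| = #|sumset A (box x m k)|.
Proof.
rewrite -card_oppset -sumsetNN -imset_comp.
have -> : [set (-%R \o -%R) a | a in A] = A.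
  by rewrite -[RHS]imset_id; apply: eq_imset => a /=; rewrite opprK.
rewrite sumsetC [in RHS]sumsetC.
rewrite -[LHS](card_sumset_translate (\sum_(i < m) x i *+ k)).
congr #|pred_of_set (sumset _ _)|.
have sym z : z \in box x m k -> \sum_(i < m) x i *+ k - z \in box x m k.
  move=> /boxP [f fk ->]; apply/boxP; exists (fun i => k - f i)%N.
    by move=> i im; apply: leq_subr.
  rewrite -sumrB; apply: eq_bigr => i _.
  by rewrite mulrnBr ?fk.
apply/setP => z; rewrite mem_translate; apply/imsetP/idP.
  move=> [b /sym bb /eqP]; rewrite subr_eq addrC => /eqP ->; exact: bb.
move=> /sym zb; exists (\sum_(i < m) x i *+ k - z) => //.
by rewrite opprB.
Qed.

End Box.

Lemma bernoulli_pow2 (R : realFieldType) (q : nat) (k : R) :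
  0 < k -> k <= q%:R -> 2 <= (1 + k^-1) ^+ q.
Proof.
move=> k0 kq; have h n : 1 + n%:R * k^-1 <= (1 + k^-1) ^+ n.
  elim: n => [|n IH]; first by rewrite mul0r addr0.
  rewrite exprS -natr1; apply: le_trans (_ : (1 + k^-1) * (1 + n%:R * k^-1) <= _).
    have t0 : 0 <= k^-1 by rewrite invr_ge0 ltW.
    by have := mulr_ge0 (ler0n R n) (mulr_ge0 t0 t0); lra.
  by rewrite ler_pM2l // addr_gt0 // invr_gt0.
have : 1 <= q%:R * k^-1 by rewrite ler_pdivlMr // mul1r.
by have := h q; lra.
Qed.

(* Doubling a box multiplies the size of [A + box] by at most [2 ^ m], so one
   of the [q * m] intermediate enlargements by [h] multiplies it by little. *)
Lemma box_slow_growth (R : realFieldType) (G : finZmodType) (A : {set G})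
    (x : nat -> G) (m q h : nat) (k : R) :
  0 < k -> k <= q%:R -> (0 < m)%N -> (0 < h)%N -> A != set0 ->
  exists2 j, (j + h < 2 * (q * m * h))%N &
    #|sumset A (box x m (j + h))|%:R
      <= (1 + k^-1) * #|sumset A (box x m j)|%:R.
Proof.
move=> k0 kq m0 h0 A0.
have q0 : (0 < q)%N by rewrite -(ltr0n R) (lt_le_trans k0).
(* With [J + 1 = q m h], the [q m] enlargements by [h] lead from [J] exactly to [2 J + 1], where
   [card_sumset_box_double] applies. *)
pose J := (q * m * h).-1; have JE : J.+1 = (q * m * h)%N.
  by rewrite prednK // !muln_gt0 q0 m0.
pose V j : R := #|sumset A (box x m j)|%:R.
have V0 j : 0 < V j.
  rewrite ltr0n card_gt0; have /set0Pn [a aA] := A0.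
  by apply/set0Pn; exists (a + 0); apply: imset2_f => //; apply: box0.
case: (boolP [exists i : 'I_(q * m), V (J + i * h + h)%N <= (1 + k^-1) * V (J + i * h)%N]).
  case/existsP => i hi; exists (J + i * h)%N => //.
  have := ltn_ord i; set b := nat_of_ord i => bi.
  have : (b * h + h <= q * m * h)%N by rewrite -mulSnr leq_mul2r bi orbT.
  by move: JE; set QQ := (q * m * h)%N; lia.
rewrite negb_exists => /forallP H.
have k1 : 0 < 1 + k^-1 by rewrite addr_gt0 // invr_gt0.
have grow n : (n < q * m)%N -> (1 + k^-1) ^+ n.+1 * V J < V (J + n.+1 * h)%N.
  elim: n => [|n IH] hn; have /= := H (Ordinal hn); rewrite -ltNge.
    by rewrite mul0n addn0 mul1n expr1.
  rewrite [(n.+2 * h)%N]mulSnr addnA; apply: lt_trans.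
  by rewrite exprS -mulrA ltr_pM2l ?IH // (ltn_trans _ hn).
have qm : (0 < q * m)%N by rewrite muln_gt0 q0.
have lt1 : (1 + k^-1) ^+ (q * m) * V J < V (J + q * m * h)%N.
  by have := grow (q * m).-1; rewrite prednK //; apply.
have := card_sumset_box_double x m A J.
rewrite -(ler_nat R) natrM natrX -/(V J).
have -> : J.*2.+1 = (J + q * m * h)%N by rewrite -JE; lia.
move=> /(lt_le_trans lt1); rewrite ltr_pM2r // ltNge => /negP[].
rewrite exprM lerXn2r ?nnegrE ?exprn_ge0 ?addr_ge0 ?invr_ge0 ?(ltW k0) //.
exact: bernoulli_pow2.
Qed.
(** * Fourier analysis *)

Section Fourier.
Variables (C : numClosedFieldType) (G : finComNzRingType) (e : G -> C).
Hypothesis eD : forall x y, e (x + y) = e x * e y.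
Hypothesis norm_e : forall x, `|e x| = 1.
Hypothesis e_eq1 : forall x, e x = 1 -> x = 0.

Definition fourier (A : {set G}) (r : G) : C := \sum_(a in A) e (r * a).

Lemma char_neq0 x : e x != 0.
Proof. by rewrite -normr_gt0 norm_e. Qed.

Lemma char0 : e 0 = 1.
Proof. by apply: (mulIf (char_neq0 0)); rewrite -eD addr0 mul1r. Qed.

Lemma charN x : e (- x) = (e x)^*.
Proof.
apply: (mulIf (char_neq0 x)).
by rewrite -eD addNr char0 mulrC -normCK norm_e expr1n.
Qed.

(** Replacing [r] by [1 + r] multiplies the sum by [e x], which differs from [1] when [x] is
    nonzero. *)
Lemma char_orthogonality x :
  \sum_(r : G) e (r * x) = if x == 0 then #|G|%:R else 0.
Proof.
case: eqP => [->|x0].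
  under eq_bigr do rewrite mulr0 char0.
  by rewrite sumr_const.
set S := \sum_r _; have eS : S = e x * S.
  rewrite {1}/S (reindex_inj (addrI 1)) mulr_sumr; apply: eq_bigr => r _.
  by rewrite mulrDl mul1r eD.
apply/eqP; have : (1 - e x) * S == 0 by rewrite mulrBl mul1r -eS subrr.
rewrite mulf_eq0 subr_eq0 => /orP[/eqP/esym/e_eq1//|//].
Qed.

Lemma fourier0 A : fourier A 0 = #|A|%:R.
Proof.
rewrite /fourier; under eq_bigr do rewrite mul0r char0.
by rewrite sumr_const.
Qed.

Lemma norm_char_sum (I : finType) (P : pred I) (b : I -> G) :
  `|\sum_(i | P i) e (b i)| <= #|P|%:R.
Proof.
apply: le_trans (ler_norm_sum _ _ _) _.
by under eq_bigr do rewrite norm_e; rewrite sumr_const.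
Qed.

(** Expand both sums and sum over [r] first: orthogonality keeps the pairs with [b i = w]. As [b]
    may repeat values, this counts with multiplicity. *)
Lemma fourier_count (I : finType) (P : pred I) (b : I -> G) (W : {set G}) :
  \sum_r (\sum_(i | P i) e (r * b i)) * (fourier W r)^*
    = (#|G| * #|[pred i | P i && (b i \in W)]|)%:R.
Proof.
have expand r : (\sum_(i | P i) e (r * b i)) * (fourier W r)^* =
    \sum_(i | P i) \sum_(w in W) e (r * (b i - w)).
  rewrite /fourier rmorph_sum big_distrlr; apply: eq_bigr => i _.
  by apply: eq_bigr => w _; rewrite mulrBr eD charN.
under eq_bigr do rewrite expand.
rewrite exchange_big natrM -[X in _ * X%:R]sum1_card [in RHS]natr_sum mulr_sumr.
rewrite [RHS](eq_bigl (fun i => P i && (b i \in W))) // big_mkcondr.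
apply: eq_bigr => i _; rewrite exchange_big /=.
under eq_bigr do rewrite char_orthogonality subr_eq0.
case: ifPn => biW.
  rewrite (bigD1 (b i)) //= eqxx big1 ?addr0 ?mulr1 // => w /andP[_].
  by rewrite eq_sym => /negPf ->.
rewrite big1 // => w wW; case: eqP => // biw.
by rewrite biw wW in biW.
Qed.

Lemma parseval (W : {set G}) :
  \sum_r `|fourier W r| ^+ 2 = (#|G| * #|W|)%:R.
Proof.
under eq_bigr do rewrite normCK.
rewrite (@fourier_count _ (mem W) id); congr (_ * _)%:R.
by apply: eq_card => x; rewrite !inE andbb.
Qed.

(* Isolate the frequency [0], and use Cauchy-Schwarz in the form
   [2 |Y^ W^| <= |Y^|^2 + |W^|^2] with Parseval for the others. *)
Lemma triple_count_le (I : finType) (b : I -> G) (A Y W : {set G}) (M : C) :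
  0 <= M ->
  (forall r, r != 0 -> `|fourier A r * \sum_i e (r * b i)| <= M) ->
  (#|G| * #|[pred p : G * G * I | (p.1.1 \in A) && (p.1.2 \in Y) &&
               (p.1.1 + p.1.2 + b p.2 \in W)]|)%:R
  <= (#|A| * #|Y| * #|I| * #|W|)%:R + M * ((#|G| * (#|Y| + #|W|))%:R / 2).
Proof.
move=> M0 hM.
have expand r : \sum_(p : G * G * I | (p.1.1 \in A) && (p.1.2 \in Y))
      e (r * (p.1.1 + p.1.2 + b p.2))
    = fourier A r * fourier Y r * \sum_i e (r * b i).
  rewrite /fourier big_distrlr pair_big /= big_distrlr pair_big /=.
  apply: eq_big => [p|p _]; first by rewrite andbT.
  by rewrite !mulrDr !eD.
rewrite -(@fourier_count _ (fun p : G * G * I => (p.1.1 \in A) && (p.1.2 \in Y))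
            (fun p => p.1.1 + p.1.2 + b p.2)).
(* [S] is a count, hence equal to its norm, which allows the triangle inequality. *)
set S := \sum_r _; have S0 : 0 <= S by rewrite /S fourier_count ler0n.
rewrite -(ger0_norm S0) /S (bigD1 0) //=; apply: le_trans (ler_normD _ _) _.
apply: lerD.
  rewrite expand !fourier0 conjC_nat.
  under eq_bigr do rewrite mul0r char0.
  by rewrite sumr_const -!natrM normr_nat.
apply: le_trans (ler_norm_sum _ _ _) _.
rewrite mulnDr natrD -!parseval -big_split mulr_suml mulr_sumr /=.
rewrite [leRHS](bigD1 0) //= -[leLHS]add0r; apply: lerD.
  by rewrite mulr_ge0 // mulr_ge0 ?invr_ge0 ?ler0n // addr_ge0 // exprn_ge0.
apply: ler_sum => r r0; rewrite expand [X in X * _]mulrAC 2!normrM norm_conjC -mulrA.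
apply: ler_pM; rewrite ?mulr_ge0 ?hM //.
rewrite ler_pdivlMr ?ltr0n // -subr_ge0.
set u := `|_|; set v := `|_|.
suff -> : u ^+ 2 + v ^+ 2 - u * v * 2 = (u - v) ^+ 2.
  by rewrite real_exprn_even_ge0 // rpredB ?normr_real.
ring.
Qed.

End Fourier.
(** * Characters of the cyclic group *)

Section Trigonometry.
Variable R : realType.
Implicit Types x y t : R.
Local Notation pi := (@pi R).

Lemma ler_cos x y : 0 <= x -> x <= y -> y <= pi -> cos y <= cos x.
Proof.
move=> x0 xy ypi.
have xi : x \in `[0, pi] by rewrite in_itv /= x0 (le_trans xy).
have yi : y \in `[0, pi] by rewrite in_itv /= ypi (le_trans x0).
by rewrite leNgt ltr_cos // -leNgt.
Qed.

Lemma cos_pi3 : cos (pi / 3) = 1 / 2.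
Proof.
have pi0 := pi_gt0 R.
have c0 : 0 < cos (pi / 3) by apply: cos_gt0_pihalf; apply/andP; split; lra.
have : cos (pi / 3 *+ 2) = - cos (pi / 3).
  have -> : pi / 3 *+ 2 = - (pi / 3) + pi by lra.
  by rewrite cosDpi cosN.
rewrite cos_mulr2n => h.
(* With [c = cos (pi / 3)], the double angle formula reads [2 c ^ 2 - 1 = - c]. *)
have : (2 * cos (pi / 3) - 1) * (cos (pi / 3) + 1) = 0 by move: h; lra.
by move/eqP; rewrite mulf_eq0 => /orP[/eqP|/eqP]; lra.
Qed.

(** Up to [pi / 3] the slope of the sine is at least [1 / 2 >= 1 / pi]; from there on the sine is at
    least [1 / 2], while [x / pi] is at most [1 / 2]. *)
Lemma sin_ge_div_pi x : 0 <= x -> x <= pi / 2 -> x / pi <= sin x.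
Proof.
move=> x0 x2; have pi2 := pi_ge2 R; have pi0 := pi_gt0 R.
rewrite ler_pdivrMr //.
have s0 : 0 <= sin x by apply: sin_ge0_pi; rewrite x0 /=; lra.
have [xs|xb] := leP x (pi / 3).
  have [|c cx] := @MVT_segment R sin cos 0 x x0 (fun z _ => is_derive_sin z).
    by apply: continuous_subspaceT; apply: continuous_sin.
  rewrite sin0 !subr0 => ->; move: cx; rewrite in_itv /= => /andP[c0 cx].
  have : 1 / 2 <= cos c by rewrite -cos_pi3; apply: ler_cos; lra.
  move=> hc; have h1 : 1 <= cos c * pi by nra.
  by rewrite mulrAC ler_peMl.
have c0 : 0 <= cos x by apply: cos_ge0_pihalf; apply/andP; split; lra.
have c1 : cos x <= 1 / 2 by rewrite -cos_pi3; apply: ler_cos; lra.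
have := sin2cos2 x => h.
have : 1 / 2 <= sin x by nra.
by nra.
Qed.

Lemma ler_dist_cos x y : x <= y -> `|cos y - cos x| <= y - x.
Proof.
move=> xy; have [|c _ ->] := @MVT_segment R cos (fun z => - sin z) x y xy
  (fun z _ => is_derive_cos z).
  by apply: continuous_subspaceT; apply: continuous_cos.
rewrite normrM normrN (ger0_norm (x := y - x)) ?subr_ge0 //.
by rewrite ler_piMl ?subr_ge0 // sin_max.
Qed.

(* 0.66 is slightly less than 2/3, and cos (2 pi / 3) = - 1 / 2. *)
Lemma cos_066pi : cos (pi * (66 / 100)) <= - (47 / 100).
Proof.
have pi0 := pi_gt0 R; have pi4 := pihalf_lt2 R.
have /ler_dist_cos : pi * (66 / 100) <= pi / 3 *+ 2 by lra.
rewrite ler_norml => /andP[h _].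
by move: h; rewrite cos_mulr2n cos_pi3; lra.
Qed.

End Trigonometry.

Section Residue.
Variable p : nat.
Implicit Types x y : 'Z_p.+2.

(** The representative of least absolute value, in [(- N / 2, N / 2]] for [N = p + 2]. *)
Definition residue x : int :=
  if (2 * x <= p.+2)%N then x%:Z else x%:Z - p.+2%:Z.

Lemma residue_bound x : 2 * `|residue x| <= p.+2%:Z.
Proof.
have : (x < p.+2)%N := ltn_ord x; rewrite /residue.
by move: (nat_of_ord x) => n h; case: leqP => ?; lia.
Qed.

Lemma residueE x : exists k : int, residue x = x%:Z + k * p.+2%:Z.
Proof. by rewrite /residue; case: ifP => _; [exists 0|exists (-1)]; lia. Qed.

Lemma residueD x y :
  exists k : int, residue (x + y) = residue x + residue y + k * p.+2%:Z.
Proof.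
have [i ->] := residueE x; have [j ->] := residueE y.
have [k ->] := residueE (x + y).
have e : nat_of_ord (x + y) = ((x + y) %% p.+2)%N by [].
have := divn_eq (x + y) p.+2; rewrite -e.
set q := (_ %/ _)%N => eq.
have {}eq : x%:Z + y%:Z = q%:Z * p.+2%:Z + (nat_of_ord (x + y)%R)%:Z.
  by rewrite -PoszD eq PoszD PoszM.
by exists (k - i - j - q%:Z); rewrite !mulrBl; lia.
Qed.

Lemma residueK x : (residue x)%:~R = x.
Proof.
rewrite -[RHS]natr_Zp /residue; case: ifP => _; first by rewrite -pmulrn.
rewrite intrB -!pmulrn; have -> : (p.+2)%:R = 0 :> 'Z_p.+2 by exact: (@char_Zp p.+2).
by rewrite subr0.
Qed.

End Residue.

Section Character.
Variables (R : realType) (p : nat).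
Implicit Types x y : 'Z_p.+2.
Local Notation N := (p.+2%:R : R).

Definition zchar x : R[i] :=
  (cos ((residue x)%:~R / N * (pi *+ 2)) +i* sin ((residue x)%:~R / N * (pi *+ 2)))%C.

Lemma periodicz (f : R -> R) T : periodic f T -> forall (k : int) a, f (a + k%:~R * T) = f a.
Proof.
move=> fT [] k a; first by rewrite -pmulrn mulr_natl; apply: periodicn.
rewrite NegzE mulrNz mulNr -pmulrn mulr_natl.
by rewrite -(periodicn fT k.+1 (a - _)) subrK.
Qed.

Lemma zcharD x y : zchar (x + y) = zchar x * zchar y.
Proof.
have N0 : N != 0 by rewrite pnatr_eq0.
rewrite /zchar; have [k ->] := residueD x y.
have -> : (residue x + residue y + k * p.+2%:Z)%:~R / N * (pi *+ 2) =
    (residue x)%:~R / N * (pi *+ 2) + (residue y)%:~R / N * (pi *+ 2)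
    + k%:~R * (pi *+ 2).
  by rewrite !rmorphD rmorphM /= -pmulrn; field; rewrite -natrD.
rewrite (periodicz (@cosD2pi R)) (periodicz (@sinD2pi R)) cosD sinD.
by apply/eqP; rewrite eq_complex /= eqxx /=; apply/eqP; ring.
Qed.

Lemma norm_zchar x : `|zchar x| = 1.
Proof. by rewrite normc_def /= cos2Dsin2 sqrtr1. Qed.

Lemma Re_zchar x : complex.Re (zchar x) = 1 - 2 * sin (`|residue x|%:~R / N * pi) ^+ 2.
Proof.
rewrite /=; have -> : (residue x)%:~R / N * (pi *+ 2) = (residue x)%:~R / N * pi *+ 2.
  by rewrite mulrnAr.
have -> : cos ((residue x)%:~R / N * pi *+ 2) = cos (`|residue x|%:~R / N * pi *+ 2).
  case: (ger0P (residue x)) => // _.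
  by rewrite mulrNz !mulNr mulNrn cosN.
rewrite cos_mulr2n cos2sin2; lra.
Qed.

Lemma residue_le_half x : `|residue x|%:~R / N <= 1 / 2.
Proof.
rewrite ler_pdivrMr ?ltr0n //; have := residue_bound x.
by rewrite -(ler_int R) rmorphM /= -[X in _ <= X -> _]pmulrn; lra.
Qed.

(** The real part is [1 - 2 sin ^ 2] of half the angle, and [sin (pi t) >= t] for [t] up to
    [1 / 2]. *)
Lemma Re_zchar_le x : complex.Re (zchar x) <= 1 - 2 * (`|residue x|%:~R / N) ^+ 2.
Proof.
have N0 : 0 < N by rewrite ltr0n.
have pi0 := pi_gt0 R.
have t0 : 0 <= `|residue x|%:~R / N by rewrite divr_ge0 ?ler0n ?ler0z ?normr_ge0.
have t2 := residue_le_half x.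
rewrite Re_zchar lerD2l lerN2 ler_pM2l ?ltr0n //.
move: t0 t2; set t := (`|_|%:~R / _) => t0 t2.
have h : t <= sin (t * pi).
  have := @sin_ge_div_pi R (t * pi); rewrite mulfK ?lt0r_neq0 //.
  by move=> h; apply: h; nra.
by rewrite lerXn2r ?nnegrE // (le_trans t0).
Qed.

Lemma zchar_eq1 x : zchar x = 1 -> x = 0.
Proof.
move=> e; have := Re_zchar_le x; rewrite e.
have -> : complex.Re (1 : R[i]) = 1 by [].
set t := (`|_|%:~R / _) => h.
have : t ^+ 2 == 0 by rewrite eq_le sqr_ge0 andbT; lra.
rewrite sqrf_eq0 mulf_eq0 invr_eq0 (negPf (lt0r_neq0 (ltr0Sn R p.+1))) orbF intr_eq0 normr_eq0.
by move=> /eqP r0; rewrite -[x]residueK r0.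
Qed.

Lemma sqr_normc_1Bzchar x :
  normc (1 - zchar x) ^+ 2 = 2 * (1 - complex.Re (zchar x)).
Proof.
have := cos2Dsin2 ((residue x)%:~R / N * (pi *+ 2)).
rewrite /normc /= sqr_sqrtr ?addr_ge0 ?sqr_ge0 //.
set c := cos _; set s := sin _ => h.
by have -> : 2 * (1 - c) = 1 - 2 * c + 1 by [ring]; rewrite -{2}h; ring.
Qed.

(** On the unit circle [|1 - z| ^ 2 = 2 (1 - Re z)], which [Re_zchar_le] bounds below by
    [4 t ^ 2]. *)
Lemma residue_le_normc x : 2 * (`|residue x|%:~R / N) <= normc (1 - zchar x).
Proof.
have := sqr_normc_1Bzchar x; have := Re_zchar_le x.
have t0 : 0 <= `|residue x|%:~R / N by rewrite divr_ge0 ?ler0n ?ler0z ?normr_ge0.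
set t := _ / _ in t0 *; set n := normc _; have n0 : 0 <= n by apply: sqrtr_ge0.
by move=> h1 h2; rewrite leNgt; apply/negP => lt; nra.
Qed.

Lemma Re_zchar_ge x : 1 - normc (1 - zchar x) <= complex.Re (zchar x).
Proof.
rewrite lerBlDr -lerBlDl.
have := normc_ge_Re (1 - zchar x); rewrite normc_def lecR => h.
by apply: le_trans h; apply: ler_norm.
Qed.

(** A larger residue gives an angle between [0.66 pi] and [pi] in absolute value, where the cosine
    is at most [- 0.47]. *)
Lemma residue_le033 x : - (47 / 100) < complex.Re (zchar x) ->
  100 * `|residue x| <= 33 * p.+2%:Z.
Proof.
move=> h; rewrite leNgt; apply/negP => big; move: h; apply/negP; rewrite -leNgt.
have N0 : 0 < N by rewrite ltr0n.
apply: le_trans (cos_066pi R).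
have pi0 := pi_gt0 R.
rewrite -[leLHS]cos_norm /= normrM normrM.
rewrite (ger0_norm (x := pi *+ 2)) ?(mulrn_wge0 _ (ltW pi0)) //.
rewrite normfV (gtr0_norm N0) -intr_norm.
have t2 := residue_le_half x.
have t1 : 33 / 100 <= `|residue x|%:~R / N.
  rewrite ler_pdivlMr //; move: big.
  rewrite -(ltr_int R) !rmorphM /= -[X in _ * X < _]pmulrn; lra.
move: t1 t2; set t := (`|_|%:~R / _) => t1 t2.
by apply: ler_cos; clear -t1 t2 pi0; nra.
Qed.

End Character.

(** * A large Fourier coefficient *)

Lemma card_pred_triple (X Y Z : finType) (P : pred (X * Y * Z)) :
  #|P| = (\sum_y \sum_z #|[pred a | P (a, y, z)]|)%N.
Proof.
transitivity (\sum_a \sum_y \sum_z (P (a, y, z) : nat))%N.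
  rewrite pair_bigA pair_bigA /= -sum1_card big_mkcond /=.
  by apply: eq_bigr => -[[a y] z] _; rewrite unfold_in /=; case: (P _).
rewrite exchange_big; apply: eq_bigr => y _ /=.
rewrite exchange_big; apply: eq_bigr => z _ /=.
rewrite -sum1_card [RHS]big_mkcond /=.
by apply: eq_bigr => a _; rewrite inE; case: (P _).
Qed.

Section TripleCount.
Variables (G : finZmodType) (A B : {set G}) (x : nat -> G) (U : nat -> {set G}).
Hypothesis gr : greedy A B x U.

(** Indexed by coefficient vectors, so that the character sum over the cube factors into geometric
    sums. Side [h] means coefficients below [h]. *)
Definition cube_sum m h (f : {ffun 'I_m -> 'I_h}) : G := \sum_(i < m) x i *+ f i.

Lemma cube_sum_box m h (f : {ffun 'I_m -> 'I_h.+1}) : cube_sum f \in box x m h.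
Proof. exact: imset_f. Qed.

Lemma greedy_box m z : z \in U m ->
  exists2 a, a \in A & exists2 b, b \in box x m 1 & z = a + b.
Proof.
rewrite (greedyE gr) => /orP[zA|/existsP [k]].
  by exists z => //; exists 0; rewrite ?box0 ?addr0.
rewrite mem_translate => za; exists (z - x k) => //.
by exists (x k); rewrite ?subrK //; apply: mem_box1.
Qed.

(* If [y' = y + b] with [y \in B] and [b] in the box, then [a + y] lies in
   [U m], itself part of [A + box 1], for all but few [a]. *)
Lemma triple_count_ge m j h (D : nat) :
  (forall y, y \in B -> (#|translate y A :\: U m| <= D)%N) ->
  ((#|A| - D) * (#|sumset B (box x m j)| * h.+1 ^ m) <=
   #|[pred p : G * G * {ffun 'I_m -> 'I_h.+1} |
       (p.1.1 \in A) && (p.1.2 \in sumset B (box x m j)) &&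
       ((p.1.1 + p.1.2 + cube_sum p.2)%R \in sumset A (box x m (j + h.+1)))]|)%N.
Proof.
move=> hD; set Y := sumset B _; set W := sumset A _.
rewrite card_pred_triple /=.
have -> : (h.+1 ^ m)%N = #|{ffun 'I_m -> 'I_h.+1}| by rewrite card_ffun !card_ord.
rewrite mulnCA -sum_nat_const [X in (_ <= X)%N](bigID (mem Y)) /=.
apply: leq_trans (leq_addr _ _); apply: leq_sum => y' y'Y.
rewrite mulnC -sum_nat_const; apply: leq_sum => f _.
have /sumsetP [y yB [b bb ey]] := y'Y.
apply: leq_trans (_ : #|A| - #|translate y A :\: U m| <= _)%N.
  by rewrite leq_sub2l ?hD.
rewrite -(card_translate y A) cardsD subKn; last exact: subset_leq_card (subsetIl _ _).
rewrite -(card_translate (- y) (translate y A :&: U m)); apply: subset_leq_card.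
apply/subsetP => a; rewrite mem_translate opprK inE mem_translate addrK.
case/andP => aA /greedy_box [a' a'A [b' b'b e]]; rewrite inE /= aA y'Y /=.
rewrite ey addrA e -!addrA; apply: imset2_f => //.
(* One unit of the box is spent on [b'], which comes from [U m], then [j] on [b] and [h] on the cube
   of side [h + 1]. *)
have -> : (j + h.+1)%N = (1 + (j + h))%N by rewrite addnS add1n.
apply: boxD => //; apply: boxD => //; exact: cube_sum_box.
Qed.

End TripleCount.

Section LargeCoefficient.
Variables (R : realType) (p : nat).
Local Notation G := ('Z_p.+2).
Local Notation e := (@zchar R p).
Local Notation fhat := (fourier e).

Lemma zchar0 : e 0 = 1.
Proof. exact: (char0 (@zcharD R p) (@norm_zchar R p)). Qed.

Lemma zcharMn x n : e (x *+ n) = e x ^+ n.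
Proof. by elim: n => [|n IH]; rewrite ?zchar0 // mulrS zcharD IH exprS. Qed.

Lemma zchar_cube (x : nat -> G) r m h :
  \sum_f e (r * @cube_sum _ x m h f)
    = \prod_(i < m) \sum_(k < h) e (r * x i) ^+ k.
Proof.
rewrite bigA_distr_bigA; apply: eq_bigr => f _; rewrite /cube_sum mulr_sumr.
rewrite (big_morph e (@zcharD R p) zchar0); apply: eq_bigr => i _.
by rewrite mulrnAr zcharMn.
Qed.

Lemma normr_normc (z : R[i]) : `|z| = (normc z)%:C%C.
Proof. by []. Qed.

Lemma normc_prod (I : finType) (F : I -> R[i]) :
  normc (\prod_i F i) = \prod_i normc (F i).
Proof. by apply: big_morph; [apply: normcM | apply: normc1]. Qed.

(* Here [k = 1 / K], and [D / a] bounds the proportion of exceptional [a]. *)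
Lemma triple_count_absurd (k a y I w n D c : R) :
  0 < k -> k <= 1 -> 0 < a -> 0 < y -> 0 < I -> 0 < n ->
  (a - D) * y * I <= c -> w <= n * k / 24 -> w <= (1 + k / 12) * y ->
  D <= 5 / 12 * k * a ->
  n * c <= a * y * I * w + (1 - k / 2) * a * I * (n * (y + w) / 2) -> False.
Proof.
move=> k0 k1 a0 y0 I0 n0 hc w1 w2 hD le1.
have h1 : n * ((a - D) * y * I) <= n * c by rewrite ler_pM2l.
have h2 : a * y * I * w <= a * y * I * (n * k / 24).
  by rewrite ler_pM2l // !mulr_gt0.
have h3 : (1 - k / 2) * a * I * (n * (y + w) / 2)
    <= (1 - k / 2) * a * I * (n * (y + (1 + k / 12) * y) / 2).
  rewrite ler_pM2l; first by rewrite ler_pM2r ?invr_gt0 // ler_pM2l // lerD2l.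
  by rewrite !mulr_gt0 //; lra.
have h4 : n * y * I * D <= n * y * I * (5 / 12 * k * a).
  by rewrite ler_pM2l // !mulr_gt0.
(* Divided by [n a y I], the bounds combine to [1 - 5 k / 12 <= 1 - 5 k / 12 - k ^ 2 / 48]. *)
have h5 : 0 < n * y * I * a * (k * k) by rewrite !mulr_gt0.
by lra.
Qed.

(** If all nonzero frequencies failed, the upper and lower bounds for the triple count would clash.
    The conditions on [m], [q] and [p] make the exceptional proportion at most [5 / (12 K)], the
    growth of the box at most [1 + 1 / (12 K)] and the density of [W] at most [1 / (24 K)]. *)
Lemma large_coefficient (A B : {set G}) (x : nat -> G) (U : nat -> {set G})
    (K : R) (m q h : nat) :
  greedy A B x U -> 0 \in B -> A != set0 ->
  (forall k, #|sumset B (box x m k)| = #|sumset A (box x m k)|) ->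
  1 <= K -> #|sumset A B|%:R = K * #|A|%:R ->
  (0 < m)%N -> (K - 1) * (12 * K) <= 5 * m.+1%:R ->
  12 * K <= q%:R ->
  (2 * (q * m * h.+1))%:R ^+ m * (24 * K) * #|A|%:R <= p.+2%:R ->
  exists2 r, r != 0 &
    (1 - (2 * K)^-1) * #|A|%:R * h.+1%:R ^+ m
    <= normc (fhat A r) * \prod_(i < m) normc (\sum_(k < h.+1) e (r * x i) ^+ k).
Proof.
move=> gr B0 A0 VE K1 dbl m0 hdelta hq hN.
have K0 : 0 < K by lra.
have a0 : 0 < #|A|%:R :> R by rewrite ltr0n card_gt0.
have [j jle grow] : exists2 j, (j + h.+1 < 2 * (q * m * h.+1))%N &
    #|sumset A (box x m (j + h.+1))|%:R
      <= (1 + (12 * K)^-1) * #|sumset A (box x m j)|%:R :> R.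
  by apply: box_slow_growth => //; lra.
set Y := sumset B (box x m j); set W := sumset A (box x m (j + h.+1)).
have Y0 : 0 < #|Y|%:R :> R.
  rewrite ltr0n card_gt0; apply/set0Pn; exists (0 + 0).
  by apply: imset2_f => //; apply: box0.
have grow' : #|W|%:R <= (1 + (12 * K)^-1) * #|Y|%:R :> R by rewrite /Y VE.
have W_small : #|W|%:R * (24 * K) <= p.+2%:R.
  apply: le_trans hN; rewrite mulrAC ler_pM2r; last by lra.
  rewrite -natrX -natrM ler_nat mulnC; apply: leq_trans (leq_card_sumset _ _) _.
  rewrite leq_mul2l; apply/orP; right; apply: leq_trans (leq_card_box _ _ _) _.
  by rewrite leq_exp2r.
pose I := {ffun 'I_m -> 'I_h.+1}.
have cI : #|I| = (h.+1 ^ m)%N by rewrite card_ffun !card_ord.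
set M := (1 - (2 * K)^-1) * _ * _.
case: (boolP [exists r, (r != 0) && (M <= normc (fhat A r) *
    \prod_(i < m) normc (\sum_(k < h.+1) e (r * x i) ^+ k))]).
  by case/existsP => r /andP [r0 hr]; exists r.
rewrite negb_exists => /forallP none.
have kk1 : (2 * K)^-1 <= 1 by rewrite invf_le1; lra.
have M0 : 0 <= M.
  by rewrite /M !mulr_ge0 ?exprn_ge0 ?ler0n // subr_ge0.
have hM r : r != 0 -> `|fhat A r * \sum_f e (r * @cube_sum _ x m h.+1 f)| <= M%:C%C.
  move=> r0; have := none r; rewrite r0 /= -ltNge => /ltW hr.
  by rewrite zchar_cube normr_normc lecR normcM normc_prod.
have Cn n : (n%:R : R[i]) = (n%:R : R)%:C%C by rewrite rmorph_nat.
have [D hD DE] := greedy_deficiency gr m B0 dbl.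
have cnt := triple_count_ge gr j h hD.
have := @triple_count_le _ _ _ (@zcharD R p) (@norm_zchar R p) (@zchar_eq1 R p)
  _ (@cube_sum _ x m h.+1) A Y W M%:C%C _ hM.
rewrite lecR => /(_ M0).
have -> : 2^-1 = (2^-1 : R)%:C%C by rewrite fmorphV rmorph_nat.
rewrite !Cn -!rmorphM -rmorphD lecR; move: cnt; rewrite -/Y -/W.
set c := (X in (_ <= X)%N -> _) => cnt le1; exfalso.
have KV : 12 * K * (5 / 12 * K^-1) = 5 by field; rewrite gt_eqF.
apply: (@triple_count_absurd (K^-1) #|A|%:R #|Y|%:R (h.+1%:R ^+ m) #|W|%:R
          p.+2%:R D%:R c%:R) => //.
- by rewrite invr_gt0.
- by rewrite invf_le1.
- by rewrite exprn_gt0.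
- move: cnt; rewrite -(ler_nat R) !natrM natrX => cnt'; apply: le_trans cnt'.
  rewrite -mulrA ler_wpM2r ?mulr_ge0 ?exprn_ge0 // lerBlDr -natrD ler_nat.
  by rewrite addnC -leq_subLR.
- by rewrite !ler_pdivlMr //; move: W_small; lra.
- by move: grow'; rewrite invfM; lra.
- have m1 : 0 < m.+1%:R :> R by rewrite ltr0n.
  rewrite -(ler_pM2l m1); apply: le_trans DE _.
  rewrite mulrA mulrA; rewrite ler_pM2r //.
  rewrite ?mulrA ler_pdivlMr //.
  by move: hdelta; lra.
- move: le1; rewrite card_ord !natrM !natrD cI natrX /M invfM; lra.
Qed.

End LargeCoefficient.

(** Replacing all factors but one by their upper bounds [a] and [H] shows that the remaining one is
    within the ratio [k] of its own bound. *)
Lemma prod_factor_ge (R : realFieldType) m (F : 'I_m -> R) (c a k H : R) :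
  0 < H -> 0 < a -> 0 <= c <= a -> (forall i, 0 <= F i <= H) ->
  k * a * H ^+ m <= c * \prod_i F i ->
  k * a <= c /\ forall i, k * H <= F i.
Proof.
move=> H0 a0 /andP[c0 ca] hF le1; split.
  rewrite -(ler_pM2r (exprn_gt0 m H0)); apply: le_trans le1 _.
  rewrite ler_wpM2l // -[X in H ^+ X](card_ord m) -prodr_const.
  by apply: ler_prod => i _; apply: hF.
move=> i; have /andP[Fi0 _] := hF i.
have P0 : 0 <= \prod_(j < m | j != i) F j.
  by apply: prodr_ge0 => j _; case/andP: (hF j).
have P1 : \prod_(j < m | j != i) F j <= H ^+ m.-1.
  apply: le_trans (_ : \prod_(j < m | j != i) H <= _).
    by apply: ler_prod => j _; apply: hF.
  rewrite prodr_const; have -> : #|[pred j | j != i]| = m.-1 => //.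
  by have := cardC1 i; rewrite card_ord => <-; apply: eq_card => j; rewrite !inE.
have m0 : (0 < m)%N by apply: leq_ltn_trans (ltn_ord i).
have aH : 0 < a * H ^+ m.-1 by rewrite mulr_gt0 ?exprn_gt0.
rewrite -(ler_pM2r aH); move: le1; rewrite (bigD1 i) //= -{1}(prednK m0) exprS.
have : c * (F i * \prod_(j < m | j != i) F j) <= F i * (a * H ^+ m.-1).
  rewrite mulrCA ler_wpM2l // ler_pM //.
by lra.
Qed.

(** * Weighted form of the greedy inequality *)

Section Weight.
Variables (R : realFieldType) (G : finZmodType) (A B : {set G}).
Variables (x : nat -> G) (U : nat -> {set G}) (w : G -> R).
Hypotheses (gr : greedy A B x U) (B0 : 0 \in B).
Hypothesis w01 : forall z, 0 <= w z <= 1.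

Lemma sum_translate y : \sum_(z in translate y A) w z = \sum_(a in A) w (a + y).
Proof. by rewrite big_imset //= => a b _ _; apply: addIr. Qed.

Lemma greedy_weight_union n (D : R) :
  \sum_(a in A) w a <= D ->
  (forall i, (i < n)%N -> \sum_(a in A) w (a + x i) <= D) ->
  \sum_(z in U n) w z <= n.+1%:R * D.
Proof.
case: gr => U0 _ US _ hA; elim: n => [|n IH] hx; first by rewrite U0 mul1r.
rewrite US -[X in _ <= X]/(n.+2%:R * D) -natr1 mulrDl mul1r.
apply: le_trans (lerD (IH _) (hx n _)) => //; last by move=> i ?; apply: hx; lia.
rewrite -sum_translate [leLHS](bigID (mem (U n))) /=; apply: lerD.
  rewrite le_eqVlt; apply/orP; left; apply/eqP; apply: eq_bigl => z.
  by rewrite inE; case: (z \in U n); rewrite ?andbF ?andbT.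
rewrite [leRHS](bigID (mem (U n))) /= -[leLHS]add0r; apply: lerD.
  by apply: sumr_ge0 => z _; case/andP: (w01 z).
rewrite le_eqVlt; apply/orP; left; apply/eqP; apply: eq_bigl => z.
by rewrite inE; case: (z \in U n); rewrite ?andbF ?andbT.
Qed.

(** As [w] is at most [1], [A + y] gains at step [j] at least its weight minus that of [U j]. The
    latter is at most [(j + 1) D], as [U j] is a union of [j + 1] translates; these losses sum to
    [n (n + 1) / 2 * D]. *)
Lemma greedy_weight n (D : R) y : y \in B ->
  \sum_(a in A) w a <= D ->
  (forall i, (i < n)%N -> \sum_(a in A) w (a + x i) <= D) ->
  #|A|%:R + n%:R * \sum_(a in A) w (a + y) - n%:R * n.+1%:R / 2 * D
    <= #|sumset A B|%:R.
Proof.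
move=> yB hA hx.
have gain j : (j < n)%N ->
    \sum_(a in A) w (a + y) - j.+1%:R * D <= #|translate y A :\: U j|%:R.
  move=> jn; have hU := greedy_weight_union hA (fun i ij => hx i (ltn_trans ij jn)).
  rewrite lerBlDl; apply: le_trans (lerD hU (lexx _)).
  rewrite -sum_translate (bigID (mem (U j))) /=; apply: lerD.
    rewrite [leRHS](bigID (mem (translate y A))) /= -[leLHS]addr0; apply: lerD.
      rewrite le_eqVlt; apply/orP; left; apply/eqP; apply: eq_bigl => z.
      by rewrite andbC.
    by apply: sumr_ge0 => z _; case/andP: (w01 z).
  rewrite -sum1_card natr_sum [leRHS](eq_bigl (fun z => (z \in translate y A) && (z \notin U j))).
    by apply: ler_sum => z _; case/andP: (w01 z).
  by move=> z; rewrite inE andbC.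
have := greedy_gains gr n B0 (fun=> yB); rewrite -(ler_nat R) natrD.
apply: le_trans; rewrite -addrA lerD2l natr_sum.
apply: le_trans (ler_sum _ (fun (j : 'I_n) _ => gain j (ltn_ord j))).
rewrite sumrB sumr_const card_ord mulr_natl lerD2l lerN2 -mulr_suml.
rewrite le_eqVlt; apply/orP; left; apply/eqP; congr (_ * _).
elim: n {hx gain} => [|n IH]; first by rewrite big_ord0 mul0r mul0r.
by rewrite big_ord_recr /= IH -!natr1; field.
Qed.

End Weight.

(** * Rectification *)

Section Rectify.
Variables (G : finZmodType) (N E : nat) (phi : G -> int).
Hypothesis phiD : forall a b, exists k : int, phi (a + b) = phi a + phi b + k * N%:Z.
Hypothesis phi_bound : forall a, 2 * `|phi a| <= N%:Z.
Hypothesis E_small : (100 * E < N)%N.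

(** The two sides differ by a multiple of [N] that is at most [3 N / 2] in absolute value. *)
Lemma phi_wrap a b : `|phi a + phi b| <= N%:Z ->
  [\/ phi (a + b) = phi a + phi b, phi (a + b) = phi a + phi b - N%:Z
    | phi (a + b) = phi a + phi b + N%:Z].
Proof.
have [k e] := phiD a b; rewrite e; move: (phi_bound (a + b)); rewrite e => h1 h2.
have : (k == 0) || (k == 1) || (k == -1).
  have : 2 * `|k * N%:Z| <= 3 * N%:Z by move: (k * N%:Z) h1 h2 => q; lia.
  have N0 : 0 < N%:Z by lia.
  by rewrite normrM (gtr0_norm N0) mulrA ler_pM2r //; lia.
by case/orP => [/orP[]|] /eqP ->; [apply: Or31|apply: Or33|apply: Or32]; lia.
Qed.

Variables (A B : {set G}) (x : nat -> G) (U : nat -> {set G}) (m : nat).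
Hypothesis gr : greedy A B x U.
Hypothesis phi_A : forall a, a \in A -> 100 * `|phi a| <= 33 * N%:Z.
Hypothesis phi_x : forall i, (i < m)%N -> `|phi (x i)| <= E%:Z.

Lemma phi_greedy j z : (j <= m)%N -> z \in U j ->
  exists2 a, a \in A & exists2 t : int, `|t| <= E%:Z & phi z = phi a + t.
Proof.
move=> jm; rewrite (greedyE gr) => /orP[zA|/existsP [i0]].
  by exists z => //; exists 0; rewrite ?addr0.
rewrite mem_translate => zA; exists (z - x i0) => //.
have hx : `|phi (x i0)| <= E%:Z by apply: phi_x; apply: leq_trans jm.
exists (phi (x i0)) => //.
have hA := phi_A zA; have hb := phi_bound z.
have [|||] := @phi_wrap (z - x i0) (x i0); rewrite ?subrK //; lia.
Qed.

Hypothesis phi_B : forall b, b \in B -> 100 * `|phi b| <= 33 * N%:Z.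

Lemma mass_beyond (D : nat) (M : int) y :
  (forall y, y \in B -> (#|translate y A :\: U m| <= D)%N) ->
  (forall a, a \in A -> phi a <= M) -> y \in B ->
  (#|[set a in A | (M - phi y + E%:Z < phi a)%R]| <= D)%N.
Proof.
move=> hD hM yB; apply: leq_trans (hD y yB).
rewrite -(card_translate y); apply/subset_leq_card/subsetP => z.
rewrite mem_translate inE => /andP[zA zM]; rewrite inE mem_translate zA andbT.
apply/negP => /(phi_greedy (leqnn m)) [a aA [t tE e]].
have h1 := hM a aA; have h2 := phi_A aA; have h3 := phi_A zA; have h4 := phi_B yB.
(* No wrap-around: three values of at most [0.33 N] and [t], less than [N / 100], cannot add up to
   [N]. *)
have [|||] := @phi_wrap (z - y) y; rewrite ?subrK ?e; lia.
Qed.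

Lemma sum_indicator (R : pzSemiRingType) (S : {set G}) (P : pred G) :
  \sum_(a in S) (P a)%:R = #|[set a in S | P a]|%:R :> R.
Proof.
rewrite -sum1_card natr_sum big_mkcond [RHS]big_mkcond /=.
by apply: eq_bigr => a _; rewrite !inE; case: (a \in S); case: (P a).
Qed.

Hypothesis B0 : 0 \in B.

(* The weight is the indicator of the complement of the arc that contains most
   of [A] and of its translates by the [x i]. *)
Lemma far_translate (R : realFieldType) (D n : nat) (c : int) y : (n <= m)%N ->
  (#|[set a in A | (c + E%:Z < phi a)%R]| <= D)%N ->
  (#|[set a in A | (phi a < c - E%:Z)%R]| <= D)%N ->
  y \in B -> (3 * E)%:Z < phi y ->
  #|A|%:R + n%:R * (#|A|%:R - D%:R) - n%:R * n.+1%:R / 2 * D%:R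
    <= #|sumset A B|%:R :> R.
Proof.
move=> nm hup hlo yB y3.
(* No [phi a + phi (x i)] lies below the left end of this arc, whereas a sum [phi a + phi y] that
   wraps around, being at most [0.66 N - N], does. *)
pose far z := ~~ ((- (33 * N%:Z + 100 * E%:Z) <= 100 * phi z)
                  && (phi z <= c + 2 * E%:Z)).
have hA a : a \in A -> far a -> c + E%:Z < phi a.
  by move=> aA; have h1 := phi_A aA; rewrite /far negb_and -!ltNge => /orP[]; lia.
have hx i0 a : (i0 < n)%N -> a \in A -> far (a + x i0) -> c + E%:Z < phi a.
  move=> i0n aA; have h1 := phi_A aA; have h2 := phi_x (leq_trans i0n nm).
  rewrite /far negb_and -!ltNge.
  have := phi_bound (a + x i0).
  by have [|||] := @phi_wrap a (x i0); try move=> ->; try move=> h3 /orP[]; lia.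
have hy a : a \in A -> c - E%:Z <= phi a -> far (a + y).
  move=> aA hc; have h1 := phi_A aA; have h2 := phi_B yB.
  rewrite /far negb_and -!ltNge; apply/orP; have := phi_bound (a + y).
  by have [|||] := @phi_wrap a y; try move=> ->; lia.
have w01 z : 0 <= ((far z)%:R : R) <= 1 by case: (far z); rewrite ?ler01 ?lexx.
have up (u : G) : (forall a, a \in A -> far (a + u) -> c + E%:Z < phi a) ->
    \sum_(a in A) (far (a + u))%:R <= D%:R :> R.
  move=> hu; rewrite (@sum_indicator _ A (fun a => far (a + u))) ler_nat.
  apply: leq_trans hup; apply/subset_leq_card/subsetP => a; rewrite !inE.
  by case/andP => aA /(hu a aA) ->; rewrite aA.
have up0 : \sum_(a in A) (far a)%:R <= D%:R :> R.
  have := up 0; under eq_bigr do rewrite addr0; apply.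
  by move=> a aA; rewrite addr0; apply: hA.
have := greedy_weight gr B0 w01 yB up0 (fun i i_n => up (x i) (fun a => hx i a i_n)).
apply: le_trans; rewrite lerD2r lerD2l ler_wpM2l ?ler0n //.
rewrite (@sum_indicator _ A (fun a => far (a + y))) lerBlDr -natrD ler_nat.
apply: leq_trans (_ : #|[set a in A | far (a + y)%R]| +
   #|[set a in A | (phi a < c - E%:Z)%R]| <= _)%N; last by rewrite leq_add2l.
apply: leq_trans (leq_card_setU _ _); apply/subset_leq_card/subsetP => a aA.
by rewrite !inE aA /=; case: ltP => [|/(hy a aA) ->]; rewrite ?orbT.
Qed.

End Rectify.

(** * Numerical contradictions from too large gains *)

Section Numerics.
Variable R : realFieldType.

(** Here [c] is [|A^(r)| / |A|], [rho] the real part of [e (r b)] and [nu] an error term. After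
    multiplication by [K] the gain per step is at least [0.735 K - 0.1175] and the loss factor at
    most [0.255]; at [n = 5 K / 2] the leading coefficient [0.735 * 5 / 2 - 0.1275 * 25 / 4] exceeds
    [1]. *)
Lemma obtuse_gain_absurd (K n c rho nu : R) : 1 <= K ->
  n <= 5 / 2 * K -> 5 / 2 * K < n + 1 -> 0 <= n ->
  1 - (2 * K)^-1 <= c -> c <= 1 -> 100 * K * nu <= 1 -> rho <= - (47 / 100) ->
  1 + n * ((1 - c * rho) / 2) - n * (n + 1) / 2 * ((1 - c + nu) / 2) <= K ->
  False.
Proof.
move=> K1 n1 n2 n0 c1 c2 hnu hrho; apply/negP; rewrite -ltNge.
have K0 : 0 < K by lra.
have ck : K - 1 / 2 <= K * c.
  have := c1; rewrite -(ler_pM2l K0) mulrBr mulr1 invfM mulrCA mulfV ?gt_eqF //; lra.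
have c0 : 0 <= c by nra.
have s1 : c * (47 / 100) <= - (c * rho) by nra.
have s2 : n * ((1 + c * (47 / 100)) / 2) <= n * ((1 - c * rho) / 2).
  by apply: ler_wpM2l => //; lra.
have s3 : K * ((1 - c + nu) / 2) <= 255 / 1000 by lra.
have s4 : n * (n + 1) / 2 * (K * ((1 - c + nu) / 2)) <= n * (n + 1) / 2 * (255 / 1000).
  by apply: ler_wpM2l => //; rewrite !mulr_ge0 //; lra.
have s5 : n * (K * ((1 + c * (47 / 100)) / 2)) >= n * (735 / 1000 * K - 1175 / 10000).
  by apply: ler_wpM2l => //; lra.
(* This bounds [n ^ 2] above by an expression linear in [n]. *)
have s6 : 0 <= (n - (5 / 2 * K - 1)) * (5 / 2 * K - n) by apply: mulr_ge0; lra.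
rewrite -(ltr_pM2l K0).
have s7 : K * (n * ((1 + c * (47 / 100)) / 2)) <= K * (n * ((1 - c * rho) / 2)).
  by rewrite ler_pM2l.
set X := n * ((1 - c * rho) / 2) in s2 s7 *.
set Y := (1 - c + nu) / 2 in s3 s4 *.
have : K * K < K + n * (735 / 1000 * K - 1175 / 10000) - n * (n + 1) / 2 * (255 / 1000).
  by nra.
move: s5 s7 s4; lra.
Qed.

(** Here [d] is the exceptional proportion, at most [(K - 1) / (12 K ^ 2 / 5)]. At [n = 5 K / 2] the
    loss is [125 K / 96] to leading order, which leaves more than [K] of the gain [5 K / 2]. *)
Lemma far_gain_absurd (K n m1 d : R) : 1 <= K ->
  n <= 5 / 2 * K -> 5 / 2 * K < n + 1 -> 0 <= n ->
  12 / 5 * K ^+ 2 < m1 -> m1 * d <= K - 1 -> 0 <= d ->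
  1 + n * (1 - d) - n * (n + 1) / 2 * d <= K -> False.
Proof.
move=> K1 n1 n2 n0 hm hd d0; apply/negP; rewrite -ltNge.
have K2 : 0 < 12 / 5 * K ^+ 2 by rewrite mulr_gt0 ?exprn_gt0 //; lra.
have hd2 : 12 / 5 * K ^+ 2 * d <= K - 1.
  by apply: le_trans hd; apply: ler_wpM2r => //; apply: ltW.
have s6 : 0 <= (n - (5 / 2 * K - 1)) * (5 / 2 * K - n) by apply: mulr_ge0; lra.
have s8 : 0 <= (K - 1) * ((n - (5 / 2 * K - 1)) * (5 / 2 * K - n)) by apply: mulr_ge0; lra.
have s7 : (n + n * (n + 1) / 2) * (12 / 5 * K ^+ 2 * d) <= (n + n * (n + 1) / 2) * (K - 1).
  by apply: ler_wpM2l => //; rewrite addr_ge0 ?mulr_ge0 //; lra.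
have s9 : 12 / 5 * K ^+ 2 * (K - 1) + (n + n * (n + 1) / 2) * (K - 1) < 12 / 5 * K ^+ 2 * n.
  nra.
rewrite -(ltr_pM2l K2); move: s7 s9; lra.
Qed.

Lemma greedy_length_le (K : R) (n m : nat) : 1 <= K ->
  n%:R <= 5 / 2 * K -> 12 / 5 * K ^+ 2 < m.+1%:R -> (n <= m)%N.
Proof.
move=> K1 hn hm; rewrite -ltnS -(ltr_nat R).
(* [5 K / 2 <= 12 K ^ 2 / 5] holds from [K = 25 / 24] on; below that, [n <= 2 <= m]. *)
have [K2|K2] := leP (25 / 24) K.
  by apply: le_lt_trans hn (le_lt_trans _ hm); nra.
have n3 : (n < 3)%N by rewrite -(ltr_nat R); lra.
have m2 : (2 < m.+1)%N by rewrite -(ltr_nat R); nra.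
by rewrite ltr_nat; lia.
Qed.

End Numerics.

(** * Size and phase of exponential sums *)

Section CoefficientBounds.
Variables (R : realType) (p : nat).
Local Notation G := ('Z_p.+2).
Local Notation e := (@zchar R p).
Local Notation fhat := (fourier e).

Lemma normc_ge0 (z : R[i]) : 0 <= normc z.
Proof. by case: z => a b; apply: sqrtr_ge0. Qed.

Lemma normc_zchar x : normc (e x) = 1.
Proof. by have := norm_zchar R x; rewrite normr_normc => -[]. Qed.

Lemma normcX (z : R[i]) n : normc (z ^+ n) = normc z ^+ n.
Proof. by elim: n => [|n IH]; rewrite ?normc1 // !exprS normcM IH. Qed.

Lemma normc_fourier_le (A : {set G}) r : normc (fhat A r) <= #|A|%:R.
Proof.
have := @norm_char_sum _ _ _ (@norm_zchar R p) _ (mem A) (fun a => r * a).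
by rewrite normr_normc -(rmorph_nat (real_complex R)) lecR.
Qed.

Lemma normc_geometric_le (z : R[i]) h : normc z = 1 ->
  normc (\sum_(k < h) z ^+ k) <= h%:R.
Proof.
move=> z1; elim: h => [|h IH]; first by rewrite big_ord0 normc0.
rewrite big_ord_recr /= -natr1; apply: le_trans (le_normcD _ _) _.
by rewrite normcX z1 expr1n lerD2r.
Qed.

(** The geometric sum telescopes: its product with [1 - z] is [1 - z ^ h], of modulus at most
    [2]. *)
Lemma normc_1B_le (z : R[i]) h : normc z = 1 -> (0 < h)%N ->
  1 / 2 * h%:R <= normc (\sum_(k < h) z ^+ k) -> normc (1 - z) * h%:R <= 4.
Proof.
move=> z1 h0 hS.
have : normc (1 - z) * normc (\sum_(k < h) z ^+ k) <= 2.
  rewrite -normcM; have -> : (1 - z) * \sum_(k < h) z ^+ k = 1 - z ^+ h.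
    by rewrite -[1 - z]opprB mulNr -subrX1 opprB.
  apply: le_trans (le_normcD _ _) _.
  by rewrite normcN normcX z1 expr1n normc1.
have := ler_wpM2l (normc_ge0 (1 - z)) hS; lra.
Qed.

(* The weight at [z] is [(1 - Re (u e(r z))) / 2], with [u] chosen so that
   [u A^(r) = |A^(r)|]: it is small on average on [A]. *)
Lemma coefficient_weight (A : {set G}) r : fhat A r != 0 ->
  exists2 w : G -> R, forall z, 0 <= w z <= 1 &
    forall y, \sum_(a in A) w (a + y)
      = (#|A|%:R - normc (fhat A r) * complex.Re (e (r * y))) / 2.
Proof.
set F := fhat A r => F0; pose f := normc F.
have f0 : 0 < f.
  by rewrite lt_neqAle normc_ge0 andbT eq_sym; apply: contra F0 => /eqP/eq0_normc ->.
pose u := f%:C%C / F.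
have uF : u * F = f%:C%C by rewrite divfK.
have nu : normc u = 1.
  apply: (mulIf (lt0r_neq0 f0)); rewrite -normcM uF mul1r.
  by rewrite /normc /= expr0n addr0 sqrtr_sqr ger0_norm // ltW.
exists (fun z => (1 - complex.Re (u * e (r * z))) / 2) => [z|y].
  have : normc (u * e (r * z)) = 1 by rewrite normcM nu normc_zchar mulr1.
  move=> h; have := normc_ge_Re (u * e (r * z)); rewrite normr_normc h lecR.
  by rewrite ler_norml => /andP[]; move=> ? ?; apply/andP; split; lra.
rewrite -mulr_suml sumrB sumr_const; congr ((_ - _) / _).
transitivity (complex.Re (\sum_(a in A) u * e (r * (a + y)))).
  by rewrite raddf_sum.
have -> : \sum_(a in A) u * e (r * (a + y)) = f%:C%C * e (r * y).
  rewrite -uF /F /fourier mulr_sumr mulr_suml; apply: eq_bigr => a _.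
  by rewrite mulrDr zcharD mulrA.
by case: (e (r * y)) => a b /=; rewrite mul0r subr0.
Qed.

End CoefficientBounds.

Lemma int_argmax (T : finType) (f : T -> int) (A : {set T}) : A != set0 ->
  exists2 a, a \in A & forall b, b \in A -> f b <= f a.
Proof.
case/set0Pn => a0 a0A; case: (@Order.TotalTheory.arg_maxP _ _ _ a0 (mem A) f a0A) => a aA h.
by exists a => // b; apply: h.
Qed.

Lemma oppset_inv (G : finZmodType) (A : {set G}) a :
  (- a \in [set - b | b in A]) = (a \in A).
Proof. by rewrite mem_imset //; apply: oppr_inj. Qed.

(** [mass_beyond] is applied to [phi] and [- phi], with [y] coming from the extreme elements [a1]
    and [a2] of [A]. For [B = A] this gives the center [0], for [B = - A] the center
    [phi a1 + phi a2]. *)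
Lemma arc_center (G : finZmodType) (N E D m : nat) (phi : G -> int) (A B : {set G}) x U :
  (forall a b, exists k : int, phi (a + b) = phi a + phi b + k * N%:Z) ->
  (forall a, 2 * `|phi a| <= N%:Z) -> (100 * E < N)%N -> phi 0 = 0 ->
  greedy A B x U -> A != set0 -> B = A \/ B = [set - a | a in A] ->
  (forall b, b \in B -> 100 * `|phi b| <= 33 * N%:Z) ->
  (forall i, (i < m)%N -> `|phi (x i)| <= E%:Z) ->
  (forall y, y \in B -> (#|translate y A :\: U m| <= D)%N) ->
  exists c : int, (forall a, a \in A -> 100 * `|phi a| <= 33 * N%:Z) /\
    (#|[set a in A | (c + E%:Z < phi a)%R]| <= D)%N /\
    (#|[set a in A | (phi a < c - E%:Z)%R]| <= D)%N.
Proof.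
move=> phiD phi2 E100 phi0 gr A0 BA phi_B phi_x hD.
have phiN a : 100 * `|phi a| <= 33 * N%:Z -> phi (- a) = - phi a.
  move=> h; have h2 := phi2 (- a).
  by have [|||] := @phi_wrap G N E phi phiD phi2 E100 (- a) a; rewrite ?addNr ?phi0; lia.
have phi_A a : a \in A -> 100 * `|phi a| <= 33 * N%:Z.
  case: BA => BE aA; first by apply: phi_B; rewrite BE.
  have := phi_B (- a); rewrite BE oppset_inv => /(_ aA) h.
  by rewrite -[a]opprK phiN // normrN.
have nphiD a b : exists k : int, - phi (a + b) = - phi a + - phi b + k * N%:Z.
  by have [k ->] := phiD a b; exists (- k); rewrite mulNr; lia.
have nphi2 a : 2 * `|- phi a| <= N%:Z by rewrite normrN.
have [a1 a1A max1] := int_argmax phi A0.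
have [a2 a2A max2] := int_argmax (fun a => - phi a) A0.
have up y := @mass_beyond G N E phi phiD phi2 E100 A B x U m gr phi_A phi_x phi_B
  D (phi a1) y hD max1.
have lo y : y \in B ->
    (#|[set a in A | (- phi a2 - - phi y + E%:Z < - phi a)%R]| <= D)%N.
  apply: (mass_beyond nphiD nphi2 E100 gr _ _ _ hD max2) => z zz; rewrite normrN.
  - exact: phi_A.
  - exact: phi_x.
  - exact: phi_B.
have [c [y1 y1B e1] [y2 y2B e2]] : exists2 c, exists2 y, y \in B & phi a1 - phi y = c
    & exists2 y, y \in B & - phi a2 + phi y = - c.
  case: BA => BE; rewrite BE.
    by exists 0; [exists a1 | exists a2] => //; lia.
  exists (phi a1 + phi a2); [exists (- a2)|exists (- a1)]; rewrite ?oppset_inv //.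
    by rewrite phiN ?phi_A //; lia.
  by rewrite phiN ?phi_A //; lia.
exists c; split=> //; split; first by have := up y1 y1B; rewrite e1.
apply: leq_trans (lo y2 y2B); apply/subset_leq_card/subsetP => a.
by rewrite !inE opprK e2 => /andP[-> h] /=; lia.
Qed.

(** * Small residues of a dilate *)

Section Structure.
Variables (R : realType) (p : nat).
Local Notation G := ('Z_p.+2).
Local Notation e := (@zchar R p).
Local Notation fhat := (fourier e).

Lemma rectification (A B : {set G}) (K : R) (m n q h : nat) :
  A != set0 -> 0 \in B -> B = A \/ B = [set - a | a in A] ->
  1 <= K -> #|sumset A B|%:R = K * #|A|%:R ->
  12 / 5 * K ^+ 2 < m.+1%:R -> n%:R <= 5 / 2 * K -> 5 / 2 * K < n%:R + 1 ->
  12 * K <= q%:R -> 400 * K <= h.+1%:R ->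
  (2 * (q * m * h.+1))%:R ^+ m * (24 * K) * #|A|%:R <= p.+2%:R ->
  exists2 r, r != 0 & forall y, y \in B ->
    h.+1%:Z * `|residue (r * y)| <= 6 * p.+2%:Z.
Proof.
move=> A0 B0 BA K1 dbl hm hn1 hn2 hq hh hN.
have a0 : 0 < #|A|%:R :> R by rewrite ltr0n card_gt0.
have nm := greedy_length_le K1 hn1 hm.
have m0 : (0 < m)%N by rewrite -ltnS -(ltr_nat R); nra.
have [x [U gr]] := greedy_exists A B0.
have VE k : #|sumset B (box x m k)| = #|sumset A (box x m k)|.
  by case: BA => ->; rewrite ?card_sumset_opp_box.
have [r r0 hr] : exists2 r, r != 0 &
    (1 - (2 * K)^-1) * #|A|%:R * h.+1%:R ^+ m
    <= normc (fhat A r) * \prod_(i < m) normc (\sum_(k < h.+1) e (r * x i) ^+ k).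
  by apply: (@large_coefficient R p A B x U K m q h) => //; nra.
exists r => //.
have h0 : 0 < h.+1%:R :> R by rewrite ltr0n.
have K2 : (2 * K)^-1 <= 1 / 2 by rewrite mul1r lef_pV2 ?posrE; lra.
have [cA cx] := prod_factor_ge h0 a0
  (introT andP (conj (normc_ge0 _) (normc_fourier_le R A r)))
  (fun i : 'I_m => introT andP (conj (normc_ge0 _)
     (normc_geometric_le h.+1 (normc_zchar R (r * x i))))) hr.
have close i : (i < m)%N -> normc (1 - e (r * x i)) * h.+1%:R <= 4.
  move=> im; apply: normc_1B_le => //; first exact: normc_zchar.
  by apply: le_trans (cx (Ordinal im)); rewrite ler_pM2r //; lra.
pose phi z := residue (r * z).
have phiD a b : exists k : int, phi (a + b) = phi a + phi b + k * p.+2%:Z.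
  by rewrite /phi mulrDr; apply: residueD.
have phi2 a : 2 * `|phi a| <= p.+2%:Z by apply: residue_bound.
have F0 : fhat A r != 0.
  apply: contraTneq cA => ->; rewrite normc0 -ltNge mulr_gt0 //; lra.
have [w w01 wE] := coefficient_weight F0.
set c := normc (fhat A r) in cA wE.
have phi_B b : b \in B -> 100 * `|phi b| <= 33 * p.+2%:Z.
  (* Otherwise [e (r b)] has real part at most [- 0.47], so that [A + b] has large weight, whereas
     [A] and the [A + x i] have small weight. *)
  move=> bB; apply: (@residue_le033 R); rewrite ltNge; apply/negP => hb.
  have ca : c <= #|A|%:R by apply: normc_fourier_le.
  have c0 : 0 <= c by apply: normc_ge0.
  pose nu : R := 4 / h.+1%:R.
  have nu0 : 0 <= nu by rewrite divr_ge0.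
  have w0 : \sum_(a in A) w a <= #|A|%:R * ((1 - c / #|A|%:R + nu) / 2).
    have := wE 0; under eq_bigr do rewrite addr0.
    rewrite mulr0 zchar0 => ->; rewrite [complex.Re 1]/=.
    have -> : #|A|%:R * ((1 - c / #|A|%:R + nu) / 2) = (#|A|%:R - c + #|A|%:R * nu) / 2.
      by field; rewrite gt_eqF.
    by have := mulr_ge0 (ltW a0) nu0; lra.
  have wx i : (i < n)%N ->
      \sum_(a in A) w (a + x i) <= #|A|%:R * ((1 - c / #|A|%:R + nu) / 2).
    move=> i_n; rewrite wE.
    have -> : #|A|%:R * ((1 - c / #|A|%:R + nu) / 2) = (#|A|%:R - c + #|A|%:R * nu) / 2.
      by field; rewrite gt_eqF.
    have := Re_zchar_ge R (r * x i); have := close i (leq_trans i_n nm).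
    rewrite -ler_pdivlMr // -/nu; set z := complex.Re _; set t := normc _ => h1 h2.
    have h3 : c * (1 - nu) <= c * z by apply: ler_wpM2l => //; lra.
    have h4 : c * nu <= #|A|%:R * nu by apply: ler_wpM2r.
    lra.
  have := greedy_weight gr B0 w01 bB w0 wx; rewrite dbl wE => le1.
  apply: (@obtuse_gain_absurd R K n%:R (c / #|A|%:R) (complex.Re (e (r * b))) nu) => //.
  - by rewrite ler_pdivlMr.
  - by rewrite ler_pdivrMr // mul1r.
  - by rewrite /nu mulrA ler_pdivrMr //; lra.
  - rewrite -(ler_pM2r a0); apply: le_trans le1; rewrite le_eqVlt; apply/orP; left.
    by apply/eqP; rewrite -natr1; field; rewrite gt_eqF.
(* The distance [4 / (h + 1)] from [1] in [close] becomes [2 N / (h + 1)] for residues; these are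
   integers, so rounding down is harmless. *)
pose E := (2 * p.+2 %/ h.+1)%N.
have Eh : (E * h.+1 <= 2 * p.+2)%N by apply: leq_trunc_div.
have phi_x i : (i < m)%N -> `|phi (x i)| <= E%:Z.
  move=> im; have := residue_le_normc R (r * x i); have := close i im.
  rewrite -/(phi (x i)) -abszE lez_nat leq_divRL // -(ler_nat R) !natrM.
  rewrite -pmulrn.
  set t := normc _ => h1 h2.
  have := h2; rewrite mulrA ler_pdivrMr ?ltr0n // => /(ler_wpM2r (ltW h0)).
  have N0 : 0 <= p.+2%:R :> R by [].
  have := ler_wpM2l N0 h1; lra.
clearbody E.
have h400 : (400 <= h.+1)%N by rewrite -(ler_nat R); lra.
have E100 : (100 * E < p.+2)%N.
  have : (E * 400 <= E * h.+1)%N by rewrite leq_mul2l h400 orbT.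
  by move: Eh; clear; move: (E * h.+1)%N => k; lia.
have [D hD DE] := greedy_deficiency gr m B0 dbl.
have phi0 : phi 0 = 0 by rewrite /phi mulr0.
have [cc [phi_A [up lo]]] := arc_center phiD phi2 E100 phi0 gr A0 BA phi_B phi_x hD.
have absurd : #|A|%:R + n%:R * (#|A|%:R - D%:R) - n%:R * n.+1%:R / 2 * D%:R
    <= #|sumset A B|%:R :> R -> False.
  rewrite dbl => le1.
  apply: (@far_gain_absurd R K n%:R m.+1%:R (D%:R / #|A|%:R)) => //.
  - by rewrite mulrA ler_pdivrMr.
  - by rewrite divr_ge0.
  - rewrite -(ler_pM2r a0); apply: le_trans le1; rewrite le_eqVlt; apply/orP; left.
    by apply/eqP; rewrite -natr1; field; rewrite gt_eqF.
have nphiD a b : exists k : int, - phi (a + b) = - phi a + - phi b + k * p.+2%:Z.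
  by have [k ->] := phiD a b; exists (- k); rewrite mulNr; clear; lia.
(* [far_translate] excludes large positive residues; applied to [- phi] with center [- cc], it
   excludes large negative ones. *)
have small y : y \in B -> `|phi y| <= (3 * E)%:Z.
  move=> yB; rewrite ler_norml; apply/andP; split; rewrite leNgt; apply/negP => far.
    apply: absurd.
    apply: (@far_translate G p.+2 E (fun a => - phi a) nphiD _ E100 A B x U m gr
              _ _ _ B0 R D n (- cc) y nm) => //.
    - by move=> a; rewrite normrN.
    - by move=> a aA; rewrite normrN; apply: phi_A.
    - by move=> i im; rewrite normrN; apply: phi_x.
    - by move=> b bB; rewrite normrN; apply: phi_B.
    - apply: leq_trans lo; apply/subset_leq_card/subsetP => a.
      by rewrite !inE => /andP[->] /=; clear; lia.
    - apply: leq_trans up; apply/subset_leq_card/subsetP => a.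
      by rewrite !inE => /andP[->] /=; clear; lia.
    - by move: far; clear; lia.
  apply: absurd.
  exact: (far_translate phiD phi2 E100 gr phi_A phi_x phi_B B0 R nm up lo yB far).
move=> y /small; rewrite -/(phi y) => hy.
have h1 : h.+1%:Z * `|phi y| <= h.+1%:Z * (3 * E)%:Z by rewrite ler_pM2l.
by apply: le_trans h1 _; move: Eh; rewrite mulnC; clear; lia.
Qed.

End Structure.

(** * Choice of the parameters *)

Section Constants.
Variable R : realType.
Implicit Types alpha K t : R.

Lemma six_pow_ge m : (2 <= m)%N -> (10 * m.+1 <= 6 ^ m)%N.
Proof. by elim: m => // -[|[|m]] IH // _; rewrite expnS; have := IH isT; lia. Qed.

(** [v] is the side of the cube before rounding down, and the [+ 1] pays for the rounding. As
    [t ^ 2 >= 256 K ^ 2], the bound on [P] gives [v >= 256 / 374.4 * t ^ 3 / K]. *)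
Lemma box_side_ge K t P v : 1 <= K -> 16 * K <= t -> 0 < P ->
  P <= 312 / 10 * K ^+ 3 -> v * (12 * P) = t ^+ 5 ->
  t ^+ 3 / (4 * K) + 1 <= v.
Proof.
move=> K1 tK P0 hP hv; have K0 : 0 < K by lra.
have t0 : 0 < t by lra.
have K3 : 0 < K ^+ 3 by rewrite exprn_gt0.
have v0 : 0 <= v.
  by rewrite -(pmulr_lge0 (x := 12 * P)) ?hv ?exprn_ge0 ?(ltW t0) // mulr_gt0.
pose s := t ^+ 3 / K; have sK : s * K = t ^+ 3 by rewrite divfK ?gt_eqF.
have t2 : 256 * K ^+ 2 <= t ^+ 2.
  have -> : 256 * K ^+ 2 = (16 * K) ^+ 2 by ring.
  by rewrite lerXn2r ?nnegrE //; lra.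
have s1 : 4096 <= s.
  rewrite ler_pdivlMr //; apply: le_trans (_ : (16 * K) ^+ 3 <= _).
    have -> : (16 * K) ^+ 3 = 4096 * K * K ^+ 2 by ring.
    rewrite ler_peMr ?expr_ge1 ?mulr_ge0 //; lra.
  by rewrite lerXn2r ?nnegrE //; lra.
have h1 : 256 * s * K ^+ 3 <= t ^+ 5.
  have -> : t ^+ 5 = s * K * t ^+ 2 by rewrite sK -exprD.
  have -> : 256 * s * K ^+ 3 = s * K * (256 * K ^+ 2) by ring.
  by rewrite ler_wpM2l // mulr_ge0; lra.
have h2 : v * (12 * P) <= v * (12 * (312 / 10 * K ^+ 3)).
  by rewrite ler_wpM2l // ler_pM2l //; lra.
have h3 : 256 * s * K ^+ 3 <= v * 12 * (312 / 10) * K ^+ 3.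
  by apply: le_trans h1 _; rewrite -hv; apply: le_trans h2 _; lra.
move: h3; rewrite ler_pM2r // => h3.
have -> : t ^+ 3 / (4 * K) = s / 4 by rewrite /s; field; rewrite gt_eqF.
lra.
Qed.

(** [ln (1 / alpha)] is at least [12 K ^ 2 * ln (16 K)], and [ln 16 >= 2]. This lets the square root
    in the final bound absorb a factor [4 K]. *)
Lemma sqrt_ln_ge alpha K : 0 < alpha -> 1 <= K ->
  alpha <= (16 * K) `^ (- (12 * K ^+ 2)) -> 4 * K <= Num.sqrt (ln (1 / alpha)).
Proof.
move=> a0 K1 ha; have X0 : 0 < 16 * K by lra.
have ln2 : 1 / 2 <= ln (2 : R).
  have := @le_ln1Dx R (- (1 / 2)); have -> : 1 + - (1 / 2) = 2^-1 :> R by lra.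
  by rewrite lnV ?posrE // => /(_ _); lra.
have ln16 : 2 <= ln (16 * K).
  apply: le_trans (_ : ln (2 ^+ 4) <= _); first by rewrite lnXn //; lra.
  by rewrite ler_ln ?posrE ?exprn_gt0 //; lra.
have hl : 16 * K ^+ 2 <= ln (1 / alpha).
  rewrite mul1r lnV ?posrE // lerNr.
  apply: le_trans (_ : ln ((16 * K) `^ (- (12 * K ^+ 2))) <= _).
    by rewrite ler_ln ?posrE ?powR_gt0.
  rewrite ln_powR mulNr lerN2.
  have : 12 * K ^+ 2 * 2 <= 12 * K ^+ 2 * ln (16 * K).
    by rewrite ler_wpM2l // mulr_ge0 ?sqr_ge0.
  by have := sqr_ge0 K; lra.
have -> : 4 * K = Num.sqrt ((4 * K) ^+ 2) by rewrite sqrtr_sqr ger0_norm //; lra.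
by apply: ler_wsqrtr; move: hl; lra.
Qed.

(** All is expressed by [t = alpha ^ (- 1 / (12 K ^ 2)) >= 16 K]. The side of the cube is about
    [t ^ 5 / (12 q m)], so the box bound is at most [(t ^ 5 / 6) ^ m]; here [t ^ (5 m) <= 1 / alpha]
    because [5 m <= 12 K ^ 2], and [6 ^ m] pays for [24 K]. The side is still at least
    [t ^ 3 / (4 K)], and [t ^ 3] is the power of [1 / alpha] in the conclusion. *)
Lemma parameters alpha K : 0 < alpha -> 1 <= K ->
  alpha <= (16 * K) `^ (- (12 * K ^+ 2)) ->
  exists m n q h : nat,
  [/\ 12 / 5 * K ^+ 2 < m.+1%:R, n%:R <= 5 / 2 * K, 5 / 2 * K < n%:R + 1,
      12 * K <= q%:R & 400 * K <= h.+1%:R] /\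
  (2 * (q * m * h.+1))%:R ^+ m * (24 * K) * alpha <= 1 /\
  h.+1%:R^-1 <= alpha `^ (1 / (4 * K ^+ 2)) * Num.sqrt (ln (1 / alpha)).
Proof.
move=> a0 K1 ha; have K0 : 0 < K by lra.
have S := sqrt_ln_ge a0 K1 ha.
pose c := 12 * K ^+ 2; have c0 : 0 < c by rewrite mulr_gt0 ?exprn_gt0.
pose t := alpha `^ (- c^-1); have t0 : 0 < t by apply: powR_gt0.
have tc : t `^ c = alpha^-1.
  by rewrite -powRrM mulNr mulVf ?gt_eqF // powR_inv1 ?ltW.
have t3 : alpha `^ (1 / (4 * K ^+ 2)) = (t ^+ 3)^-1.
  rewrite -powR_invn ?ltW // -powRrM; congr (_ `^ _).
  by rewrite /c; field; rewrite gt_eqF.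
have tK : 16 * K <= t.
  have X0 : 0 <= 16 * K by lra.
  have -> : 16 * K = ((16 * K) `^ c) `^ c^-1 by rewrite -powRrM mulfV ?gt_eqF // powRr1.
  have -> : t = (alpha^-1) `^ c^-1 by rewrite -tc -powRrM mulfV ?gt_eqF // powRr1 // ltW.
  apply: ge0_ler_powR; rewrite ?nnegrE ?powR_ge0 ?invr_ge0 ?(ltW a0) ?(ltW c0) //.
  rewrite -[(16 * K) `^ c]invrK -powRN lef_pV2 ?posrE //.
  by rewrite powR_gt0; lra.
have [m m1 m2] : exists2 m : nat, m%:R <= 12 / 5 * K ^+ 2 & 12 / 5 * K ^+ 2 < m.+1%:R.
  have /truncn_itv /andP[] : 0 <= 12 / 5 * K ^+ 2 by have := sqr_ge0 K; lra.
  by exists (Num.truncn (12 / 5 * K ^+ 2)).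
have [n n1 n2] : exists2 n : nat, n%:R <= 5 / 2 * K & 5 / 2 * K < n.+1%:R.
  have /truncn_itv /andP[] : 0 <= 5 / 2 * K by lra.
  by exists (Num.truncn (5 / 2 * K)).
have [q q1 q2] : exists2 q : nat, 12 * K <= q%:R & q%:R <= 12 * K + 1.
  have /truncn_itv /andP[] : 0 <= 12 * K by lra.
  exists (Num.truncn (12 * K)).+1; first exact: ltW.
  by rewrite -natr1 lerD2r.
have m_ge2 : (2 <= m)%N by rewrite -ltnS -(ltr_nat R); nra.
have q0 : (0 < q)%N by rewrite -(ltr_nat R); lra.
pose P : R := q%:R * m%:R.
have P0 : 0 < P by rewrite mulr_gt0 ?ltr0n // ltnW.
(* From [q <= 12 K + 1 <= 13 K] and [13 * 12 / 5 = 31.2]. *)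
have hP : P <= 312 / 10 * K ^+ 3.
  apply: le_trans (_ : (13 * K) * (12 / 5 * K ^+ 2) <= _); last by lra.
  by apply: ler_pM => //; lra.
pose v := t ^+ 5 / (12 * P).
have hv : v * (12 * P) = t ^+ 5 by rewrite divfK // mulf_neq0 // gt_eqF.
have vge := box_side_ge K1 tK P0 hP hv.
have t30 : 0 < t ^+ 3 / (4 * K) by rewrite divr_gt0 ?exprn_gt0 // mulr_gt0.
have /truncn_itv /andP[] : 0 <= v by lra.
set h1 := Num.truncn v => h1v; rewrite -natr1 => vh1.
have h1ge : t ^+ 3 / (4 * K) <= h1%:R by lra.
have h10 : (0 < h1)%N by rewrite -(ltr_nat R) (lt_le_trans t30).
(* The side of the cube is [h + 1], so [h] is one less than [h1]. *)
exists m, n, q, h1.-1; rewrite prednK //; split; [split=> //|split].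
- by rewrite natr1.
- apply: le_trans h1ge; rewrite ler_pdivlMr ?mulr_gt0 //.
  apply: le_trans (_ : (16 * K) ^+ 3 <= _); first by nra.
  by rewrite lerXn2r ?nnegrE //; lra.
- have le6 : (2 * (q * m * h1))%:R <= t ^+ 5 / 6.
    rewrite !natrM -/P; have := ler_wpM2l (ltW P0) h1v; move: hv; lra.
  have m24 : 24 * K <= 6 ^+ m.
    have := six_pow_ge m_ge2; rewrite -(ler_nat R) natrM natrX; apply: le_trans.
    by nra.
  have t1 : 1 <= t by lra.
  have tm : t ^+ (5 * m) <= alpha^-1.
    rewrite -tc -powR_mulrn ?(ltW t0) //; apply: ler_powR => //.
    by rewrite natrM /c; lra.
  apply: le_trans (_ : (t ^+ 5 / 6) ^+ m * 6 ^+ m * alpha <= _).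
    apply: ler_wpM2r; first exact: ltW.
    apply: ler_pM => //; rewrite ?exprn_ge0 //; first by lra.
    by rewrite lerXn2r ?nnegrE // divr_ge0 ?exprn_ge0 ?(ltW t0).
  rewrite -exprMn divfK ?pnatr_eq0 // -exprM.
  by move: tm; rewrite -(ler_pM2r a0) mulVf ?gt_eqF.
- rewrite t3; apply: le_trans (_ : (t ^+ 3)^-1 * (4 * K) <= _); last first.
    by rewrite ler_wpM2l // invr_ge0 exprn_ge0 ?(ltW t0).
  rewrite -[X in X <= _]mul1r ler_pdivrMr ?ltr0n //.
  have t3p : 0 < t ^+ 3 by rewrite exprn_gt0.
  move: h1ge; rewrite ler_pdivrMr ?mulr_gt0 // => h1ge.
  by rewrite -mulrA mulrC ler_pdivlMr // mul1r mulrC.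
Qed.

End Constants.

(** * From small residues to the diameter *)

Lemma diam_le (N L : nat) (A : {set 'Z_N}) (a d : 'Z_N) :
  (forall b, b \in A -> exists2 k : int, `|k| <= L%:Z & b = a + d *~ k) ->
  (diam A <= 2 * L)%N.
Proof.
move=> hA; rewrite /diam; case: ex_minnP => l _; apply.
apply/existsP; exists (a - d *+ L); apply/existsP; exists d.
apply/subsetP => b /hA [k kL ->]; apply/imsetP.
have kn : (absz (k + L%:Z)%R < (2 * L).+1)%N by lia.
exists (Ordinal kn) => //=.
have -> : d *+ absz (k + L%:Z) = d *~ (k + L%:Z).
  by rewrite pmulrn abszE ger0_norm //; lia.
by rewrite mulrzDr -pmulrn [d *~ k + _]addrC addrA subrK.
Qed.

Lemma Zp_prime_unit (p : nat) (r : 'Z_p.+2) : prime p.+2 -> r != 0 ->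
  r \is a GRing.unit.
Proof.
move=> pp r0.
by rewrite -[r]natr_Zp unitZpE // prime_coprime // gtnNdvd // lt0n.
Qed.

Lemma sumset_oppset (G : finZmodType) (A : {set G}) y :
  sumset (translate y A) [set - a | a in translate y A] = diffset A A.
Proof.
apply/setP => z; apply/sumsetP/imset2P.
  move=> [_ /imsetP [a aA ->] [_ /imsetP [_ /imsetP [b bA ->] ->] ->]].
  by exists a b; rewrite // opprD addrACA subrr addr0.
move=> [a b aA bA ->]; exists (a + y); first exact: imset_f.
exists (- (b + y)); first by apply/imset_f/imset_f.
by rewrite opprD addrACA subrr addr0.
Qed.

Theorem theorem1 (R : realType) (N : nat) (alpha K : R) (A : {set 'Z_N})
    (N_prime : prime N)
    (alpha_gt0 : 0 < alpha) (alpha_lt1 : alpha < 1)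
    (K_ge1 : 1 <= K)
    (cardA : #|A|%:R = alpha * N%:R)
    (doublingA : (minn #|sumset A A| #|diffset A A|)%:R = K * #|A|%:R)
    (alpha_small : alpha <= (16 * K) `^ (- (12 * K ^+ 2))) :
  (diam A)%:R
    <= 12 * alpha `^ (1 / (4 * K ^+ 2)) * Num.sqrt (ln (1 / alpha)) * N%:R.
Proof.
have [m [n [q [h [[hm hn1 hn2 hq hh] [hsize hbound]]]]]] :=
  parameters alpha_gt0 K_ge1 alpha_small.
case: N N_prime A cardA doublingA => [|[|p]] // N_prime A cardA doublingA.
have N0 : 0 < p.+2%:R :> R by rewrite ltr0n.
have A0 : A != set0.
  by rewrite -card_gt0 -(ltr_nat R) cardA mulr_gt0.
have [a0 a0A] := set0Pn _ A0.
pose A1 := translate (- a0) A.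
have A1_0 : 0 \in A1 by rewrite mem_translate sub0r opprK.
have cA1 : #|A1| = #|A| := card_translate _ _.
(* [B] is [A1] or its negative according to which of [A + A] and [A - A] is the smaller; both sizes
   are invariant under translation of [A]. *)
have [B [BA B0 dbl]] : exists B, [/\ B = A1 \/ B = [set - a | a in A1], 0 \in B
    & #|sumset A1 B|%:R = K * #|A1|%:R].
  case: (leqP #|sumset A A| #|diffset A A|) => le1.
    exists A1; split=> //; first by left.
    by rewrite card_sumset_translate sumsetC card_sumset_translate cA1 -doublingA (minn_idPl le1).
  exists [set - a | a in A1]; split; first by right.
    by rewrite -oppr0 oppset_inv.
  by rewrite sumset_oppset cA1 -doublingA (minn_idPr (ltnW le1)).
have [r r0 hr] : exists2 r, r != 0 & forall y, y \in B ->
    h.+1%:Z * `|residue (r * y)| <= 6 * p.+2%:Z.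
  apply: (@rectification R p A1 B K m n q h) => //.
    by apply/set0Pn; exists 0.
  rewrite cA1 cardA mulrA -[leRHS]mul1r; exact: ler_wpM2r (ltW N0) _ _ hsize.
have ru := Zp_prime_unit N_prime r0.
pose L := (6 * p.+2 %/ h.+1)%N.
have hL y : y \in B -> `|residue (r * y)| <= L%:Z.
  move=> /hr hy; rewrite -abszE lez_nat leq_divRL // mulnC.
  by move: hy; clear; lia.
have hdiam : (diam A <= 2 * L)%N.
  (* Dividing by the unit [r] turns small residues of [r y] into few steps of a progression with
     difference [r^-1], or [- r^-1] when [B] is the negative of [A1]. *)
  have rK y : y = r^-1 *~ residue (r * y).
    by rewrite -[r^-1]mulr1 -mulrzAr residueK mulKr.
  case: BA => BE.
    apply: (@diam_le _ L A a0 r^-1) => b bA.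
    exists (residue (r * (b - a0))); last by rewrite -rK addrC subrK.
    by apply: hL; rewrite BE mem_translate opprK subrK.
  apply: (@diam_le _ L A a0 (- r^-1)) => b bA.
  exists (residue (r * (- (b - a0)))); last by rewrite mulNrz -rK opprK addrC subrK.
  by apply: hL; rewrite BE oppset_inv mem_translate opprK subrK.
apply: le_trans (_ : 12 * p.+2%:R * h.+1%:R^-1 <= _).
  rewrite ler_pdivlMr ?ltr0n // -!natrM ler_nat.
  apply: leq_trans (_ : 2 * L * h.+1 <= _)%N; first by rewrite leq_mul2r hdiam orbT.
  have := leq_trunc_div (6 * p.+2) h.+1; rewrite -/L -mulnA; move: (L * h.+1)%N.
  by clear; lia.
have := ler_wpM2l (ler0n R 12) (ler_wpM2r (ltW N0) hbound).
by rewrite -!mulrA [p.+2%:R * _]mulrC.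
Qed.
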